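(* There exists $0<c_\infty<+\infty$ such that $$\lim_{l\to+\infty}c_l=c_\infty,\qquad\text{where } c_l:=\min_{u\in\mathcal U_l}\frac1l\int_0^l\int_0^l\frac{|u(x)-u(y)|^2}{|x-y|^2}\,dx\,dy\quad (l>0).$$
   Context: Fix constants $\lambda,\Lambda>0$ with $\Lambda\ge\lambda$, and $\delta>0$. For $l>0$ let $\mathcal{AD}_l$ be the family of finite sets $X=\{x_1,\dots,x_N\}\subset(-\frac\delta2,\,l+\frac\delta2)$, $N\in\mathbb N$, $x_1<x_2<\dots<x_N$, such that the intervals $(x_i-\frac\delta2,x_i+\frac\delta2)$ are mutually disjoint; the empty set is also allowed, $\emptyset\in\mathcal{AD}_l$. For $X\in\mathcal{AD}_l$, $u_X\in W^{1,\infty}(0,l)$ denotes a function, determined up to an additive constant, with $$u_X'=\lambda-(\Lambda+\lambda)\,\chi_{(0,l)}\sum_{i=1}^N\chi_{(x_i-\frac\delta2,x_i+\frac\delta2)}.$$ Let $\mathcal U_l:=\{u_X : X\in\mathcal{AD}_l\}$ (all choices of additive constants are included). The minimum defining $c_l$ exists by the direct method. *)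

(* Defs.v *)
From HB Require Import structures.
From mathcomp Require Import all_boot all_order all_algebra.
From mathcomp Require Import all_classical all_reals all_analysis.

Set Implicit Arguments.
Unset Strict Implicit.
Unset Printing Implicit Defensive.

Import Order.TTheory GRing.Theory Num.Theory.
Import numFieldNormedType.Exports.

Local Open Scope classical_set_scope.
Local Open Scope ring_scope.

Definition C1c (R : realType) (a b : R) (phi : R -> R) : Prop :=
  [/\ (forall x, derivable phi x 1), continuous (derive1 phi : R -> R),
      compact (closure [set x | phi x != 0]) &
      closure [set x | phi x != 0] `<=` `]a, b[].

(* Functions are represented by total functions on R, of which only the values
   on ]a, b[ matter (up to null sets); restricting by `\_` extends them by 0. *)
Definition Linfty (R : realType) (a b : R) (u : R -> R) : Prop :=
  u \_ `]a, b[ \in Lfun (@lebesgue_measure R) +oo%E.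

(* u belongs to W^{1,oo}(a, b) and v is its weak derivative.  The space of test
   functions is C^1_c(a, b), as in H. Brezis, Functional Analysis, Sobolev
   Spaces and PDE, Section 8.2. *)
Definition W1infty_deriv (R : realType) (a b : R) (u v : R -> R) : Prop :=
  [/\ Linfty a b u, Linfty a b v &
      forall phi : R -> R, C1c a b phi ->
        \int[@lebesgue_measure R]_(x in `]a, b[) (u x * derive1 phi x) =
        - \int[@lebesgue_measure R]_(x in `]a, b[) (v x * phi x)].

Definition AD (R : realType) (delta l : R) : set (set R) :=
  [set X | [/\ finite_set X,
               X `<=` `]- (delta / 2), l + delta / 2[ &
               trivIset X (fun x => `]x - delta / 2, x + delta / 2[%classic)]].

Definition slope (R : realType) (lambda Lambda delta l : R) (X : set R) (t : R) : R :=
  lambda - (Lambda + lambda) * ((\1_(`]0, l[%classic) t : R) *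
    \sum_(x \in X) (\1_(`]x - delta / 2, x + delta / 2[%classic) t : R)).

Definition admissible (R : realType) (lambda Lambda delta l : R) : set (R -> R) :=
  [set u | exists2 X, AD delta l X &
                      W1infty_deriv 0 l u (slope lambda Lambda delta l X)].

(* On the diagonal, a null set, the integrand is 0 since 0^-1 = 0. *)
Definition energy (R : realType) (l : R) (u : R -> R) : \bar R :=
  ((l^-1)%:E * \int[@lebesgue_measure R]_(x in `]0%R, l[)
     \int[@lebesgue_measure R]_(y in `]0%R, l[)
       (`|u x - u y| ^+ 2 / `|x - y| ^+ 2)%:E)%E.

Definition min_energy (R : realType) (lambda Lambda delta l : R) : \bar R :=
  ereal_inf (energy l @` admissible lambda Lambda delta l).

(* Main.v *)
Require Import Defs.
From HB Require Import structures.
From mathcomp Require Import all_boot all_order all_algebra finmap.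
From mathcomp Require Import all_classical all_reals all_analysis.
From mathcomp Require Import ess_sup_inf measurable_realfun ring lra.

Import Order.TTheory GRing.Theory Num.Theory.
Import numFieldNormedType.Exports.

Local Open Scope classical_set_scope.
Local Open Scope ring_scope.

Set Implicit Arguments.
Unset Strict Implicit.
Unset Printing Implicit Defensive.

(** Write E_l(u) for the double integral over ]0, l[ x ]0, l[, so that c_l is
    the least value of E_l divided by l, and let e(l) be the least value of E_l.

    If u is admissible for the length a + b, its restriction to ]0, a[ and its
    translated restriction to ]a, a + b[ are admissible for the lengths a and b:
    an interval that misses the window only shifts u by a constant there. Since
    the integrand is nonnegative, discarding the interaction between the two
    windows gives e(a + b) >= e(a) + e(b) ([gagliardo_superadditive]). By
    Fekete's lemma ([superadditive_cvg]) c_l = e(l) / l then converges to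
    sup_l c_l, provided c_l is bounded.

    The limit is finite because intervals repeated with the period over which
    the slopes lambda and - Lambda cancel give a bounded Lipschitz function: its
    integrand is dominated by C / (1 + (x - y)^2), whose integral in y is at most
    C pi whatever l is ([exists_packed_bounded]). It is positive because an
    admissible function is affine with nonzero slope on some subinterval
    ([gagliardo_gt0]).

    Two facts turn this argument on minimizers into a proof. The energy of a
    function given by its weak derivative is that of an explicit antiderivative,
    the profile of the packing of intervals ([energy_admissibleE]); this is the
    du Bois-Reymond lemma ([W1infty_deriv0_ae_cst]). And the minimum is attained
    ([exists_packed_minimizer]): the number of intervals is bounded in terms of
    l, an interval that has left the window may be parked at its edge, so the
    centres range over a compact subset of R^N, and the energy is continuous
    there since changing a Lipschitz function by a small amount changes its
    energy little ([gagliardo_perturb]). *)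

(** * Ramps and the antiderivatives of the admissible slopes *)

Definition ramp (R : realType) (a x : R) : R := Num.max (x - a) 0.

(** The length of the part of ]p - delta / 2, p + delta / 2[ to the left of x. *)
Definition overlap (R : realType) (delta p x : R) : R :=
  ramp (p - delta / 2) x - ramp (p + delta / 2) x.

(** On ]0, l[ this is an antiderivative of the slope attached to the centres in
    s. Taking the ramp with kink 0 for the linear term makes ramps the only
    building blocks. *)
Definition profile (R : realType) (lambda Lambda delta : R) (s : seq R) (x : R)
    : R :=
  lambda * ramp 0 x - (Lambda + lambda) * \sum_(p <- s) overlap delta p x.

Section Ramp.
Variable R : realType.
Implicit Types a b x y d p q : R.

Lemma ramp_ge0 a x : 0 <= ramp a x.
Proof. by rewrite /ramp le_max lexx orbT. Qed.

Lemma rampL a x : x <= a -> ramp a x = 0.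
Proof. by move=> ?; rewrite /ramp /Num.max; case: ltP => // ?; lra. Qed.

Lemma rampR a x : a <= x -> ramp a x = x - a.
Proof. by move=> ?; rewrite /ramp /Num.max; case: ltP => // ?; lra. Qed.

Variant ramp_spec a x : R -> Type :=
| RampL of x <= a : ramp_spec a x 0
| RampR of a <= x : ramp_spec a x (x - a).

Lemma rampP a x : ramp_spec a x (ramp a x).
Proof.
case: (leP x a) => h; first by rewrite rampL //; constructor.
by rewrite rampR ?ltW//; constructor; rewrite ltW.
Qed.

(** A ramp with a smaller kink has slope 1 on a larger half-line. *)
Lemma ramp_incr_antitone a b x y : a <= b -> y <= x ->
  ramp b x - ramp b y <= ramp a x - ramp a y.
Proof.
by move=> ab yx; case: (rampP b x) => ?; case: (rampP b y) => ?;
  case: (rampP a x) => ?; case: (rampP a y) => ?; lra.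
Qed.

Lemma ramp_incr a x y : y <= x -> 0 <= ramp a x - ramp a y <= x - y.
Proof. by move=> yx; case: (rampP a x) => ?; case: (rampP a y) => ?; lra. Qed.

Lemma ramp_lip a x y : `|ramp a x - ramp a y| <= `|x - y|.
Proof.
rewrite ler_norml.
by case: (rampP a x); case: (rampP a y) => *; case: (ger0P (x - y)) => *; lra.
Qed.

Lemma lipschitz_continuous (f : R -> R) (k : R) :
  (forall x y, `|f x - f y| <= k * `|x - y|) -> continuous f.
Proof.
move=> H x; apply/cvgrPdist_le => e e0; near=> y.
apply: (le_trans (H x y)).
apply: (@le_trans _ _ ((`|k| + 1) * `|x - y|)).
  by rewrite ler_wpM2r// (le_trans (ler_norm k))// lerDl.
rewrite mulrC -ler_pdivlMr ?ltr_wpDl//.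
near: y; apply: cvgr_dist_le; first exact: cvg_id.
by rewrite divr_gt0 ?ltr_wpDl.
Unshelve. all: by end_near. Qed.

Lemma continuous_ramp a : continuous (ramp a).
Proof.
by apply: (@lipschitz_continuous _ 1) => x y; rewrite mul1r ramp_lip.
Qed.

Lemma overlap_lip d p q x y : 0 < d ->
  `|overlap d p x - overlap d q y| <= `|x - y| + `|p - q|.
Proof.
move=> d0; rewrite /overlap ler_norml.
case: (ger0P (x - y)) => ?; case: (ger0P (p - q)) => ?;
case: (rampP _ x) => ?; case: (rampP _ x) => ?;
case: (rampP _ y) => ?; case: (rampP _ y) => ?; lra.
Qed.

Lemma overlapL d p x : 0 < d -> x <= p - d / 2 -> overlap d p x = 0.
Proof. by move=> d0 h; rewrite /overlap !rampL ?subr0//; lra. Qed.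

Lemma overlapR d p x : 0 < d -> p + d / 2 <= x -> overlap d p x = d.
Proof. by move=> d0 h; rewrite /overlap !rampR//; lra. Qed.

Lemma is_derive_quad (f : R -> R) x d :
  (forall h, `|f (x + h) - f x - h * d| <= h ^+ 2) -> is_derive x 1 f d.
Proof.
move=> H.
have cv : (fun h : R => h^-1 *: (f (h *: 1 + x) - f x)) @ 0^' --> d.
  apply/cvgrPdist_le => e e0; near=> h.
  have h0 : h != 0 by near: h; exact: nbhs_dnbhs_neq.
  have -> : d - h^-1 *: (f (h *: 1 + x) - f x) =
            - (h^-1 * (f (x + h) - f x - h * d)).
    by rewrite /GRing.scale/= mulr1 (addrC h x); field.
  rewrite normrN normrM normfV.
  rewrite ler_pdivrMl ?normr_gt0//; apply: (le_trans (H h)).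
  rewrite -normr_id -real_normK ?num_real// normr_id expr2 ler_wpM2l//.
  near: h; apply: dnbhs0_le => //.
by split; [apply/cvg_ex; exists d|apply/cvg_lim].
Unshelve. all: by end_near. Qed.

(** The C^1 antiderivative of a ramp. *)
Definition qramp a x : R := ramp a x ^+ 2 / 2.

Lemma is_derive_qramp a x : is_derive x 1 (qramp a) (ramp a x).
Proof.
apply: is_derive_quad => h; rewrite /qramp ler_norml.
by case: (rampP a (x + h)); case: (rampP a x) => *; apply/andP; split; nra.
Qed.

End Ramp.

(** * Essentially bounded functions and weak derivatives *)

Section Linfty.
Variable R : realType.
Implicit Types (a b l M : R) (u v f : R -> R).
Local Notation mu := (@lebesgue_measure R).

Lemma ae_imp (P Q : R -> Prop) :
  (forall x, P x -> Q x) -> {ae mu, forall x, P x} -> {ae mu, forall x, Q x}.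
Proof.
move=> PQ [N [mN N0 sub]]; exists N; split => // x /= nQ.
by apply: sub => /= /PQ.
Qed.

Lemma bounded_Linfty a b M u : measurable_fun `]a, b[%classic u ->
  (forall x, a < x < b -> `|u x| <= M) -> Linfty a b u.
Proof.
move=> mu_ uM; have mD : measurable (`]a, b[%classic : set R) by [].
have mr : measurable_fun [set: R] (u \_ `]a, b[) by apply/(measurable_restrictT _ mD).
rewrite /Linfty inE; apply/andP; split; first by rewrite inE.
rewrite inE /= /finite_norm unlock.
case: ifPn => // _; apply: (@le_lt_trans _ _ (`|M|)%:E); last exact: ltry.
apply/ess_supP; apply: nearW => x /=; rewrite lee_fin patchE.
case: ifPn => [|_]; last by rewrite normr0.
rewrite inE/= in_itv/= => xab.
by rewrite (le_trans (uM _ xab))// ler_norm.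
Qed.

Lemma Linfty_measurable a b u :
  Linfty a b u -> measurable_fun [set: R] (u \_ `]a, b[).
Proof. by move=> /sub_Lfun_mfun; rewrite inE. Qed.

Lemma Linfty_bounded a b u : Linfty a b u ->
  exists2 M : R, 0 <= M & {ae mu, forall x, `]a, b[%classic x -> `|u x| <= M}.
Proof.
move=> /sub_Lfun_finLfun; rewrite inE /= /finite_norm unlock.
case: ifPn => [_|]; last first.
  have muT : mu [set: R] = +oo%E by rewrite -set_itvNyy lebesgue_measure_itv.
  by move=> /negP[]; rewrite [X in (_ < X)%E]muT.
rewrite (_ : abse \o _ = EFin \o (Num.norm \o (u \_ `]a, b[))); last exact/funext.
move=> /ess_supr_bounded[M aeM]; exists `|M| => //.
apply: filterS aeM => x /= xM abx; apply: le_trans (ler_norm M).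
by move: xM; rewrite patchE mem_set.
Qed.

Lemma continuous_integrable a b f : continuous f ->
  mu.-integrable `]a, b[%classic (EFin \o f).
Proof.
move=> cf; apply: (@integrableS _ _ _ mu `[a, b]%classic) => //.
  by move=> x /=; rewrite !in_itv/= => /andP[? ?]; rewrite !ltW.
apply: continuous_compact_integrable; first exact: segment_compact.
exact: continuous_subspaceT.
Qed.

Lemma continuous_bounded a b f : continuous f ->
  exists2 M : R, 0 <= M & forall x, a < x < b -> `|f x| <= M.
Proof.
move=> cf.
have /compact_bounded[M [_ Mf]] : compact (f @` `[a, b]).
  by apply: continuous_compact; [exact: continuous_subspaceT|
                                exact: segment_compact].
exists (`|M| + 1); first by rewrite addr_ge0.
move=> x /andP[ax xb]; apply: (Mf (`|M| + 1)).
  by rewrite (le_lt_trans (ler_norm M))// ltrDl.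
by exists x => //=; rewrite in_itv/= !ltW.
Qed.

Lemma Linfty_integrable_bounded a b K u f : a < b -> Linfty a b u ->
  measurable_fun `]a, b[%classic f -> 0 <= K ->
  (forall x, a < x < b -> `|f x| <= K) ->
  mu.-integrable `]a, b[%classic (fun x => (u x * f x)%:E).
Proof.
move=> ab uL mf K0 fK; have mD : measurable (`]a, b[%classic : set R) by [].
have [M M0 uM] := Linfty_bounded uL.
have mu_ : measurable_fun `]a, b[%classic u.
  apply/(measurable_restrictT _ mD).
  exact: (Linfty_measurable uL).
have muf : measurable_fun `]a, b[%classic (fun x => (u x * f x)%:E).
  by apply/measurable_EFinP; exact: measurable_funM.
apply/integrableP; split => //.
apply: (@le_lt_trans _ _ (\int[mu]_(x in `]a, b[) (M * K)%:E)%E).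
  apply: ae_ge0_le_integral => //.
  - exact: measurableT_comp.
  - by move=> x _; rewrite lee_fin mulr_ge0.
  - apply: ae_imp uM => x uM xab; rewrite abse_EFin lee_fin normrM ler_pM//.
      exact: uM.
    by apply: fK; move: xab; rewrite /= in_itv.
by rewrite integral_cst//= lebesgue_measure_itv/= lte_fin ab -EFinM ltry.
Qed.

Lemma Linfty_integrableM a b u f : a < b -> Linfty a b u -> continuous f ->
  mu.-integrable `]a, b[%classic (fun x => (u x * f x)%:E).
Proof.
move=> ab uL cf; have [K K0 fK] := continuous_bounded a b cf.
apply: (Linfty_integrable_bounded ab uL _ K0 fK).
apply: (@measurable_funS _ _ _ _ setT) => //.
exact: continuous_measurable_fun.
Qed.

Lemma integrableB_EFin (D : set R) f g : measurable D ->
  mu.-integrable D (EFin \o f) -> mu.-integrable D (EFin \o g) ->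
  mu.-integrable D (EFin \o (fun x => f x - g x)).
Proof.
move=> mD If Ig; rewrite (_ : _ \o _ = (fun x => (f x)%:E - (g x)%:E)%E)//.
exact: (@integrableB _ _ _ mu).
Qed.

Lemma integrableZ_EFin (D : set R) (k : R) f : measurable D ->
  mu.-integrable D (EFin \o f) -> mu.-integrable D (EFin \o (fun x => k * f x)).
Proof.
move=> mD If; rewrite (_ : _ \o _ = (fun x => k%:E * (f x)%:E)%E)//.
exact: (@integrableZl _ _ _ mu).
Qed.

End Linfty.

Section WeakDerivative.
Variable R : realType.
Implicit Types (a b l k : R) (u v w phi : R -> R).
Local Notation mu := (@lebesgue_measure R).

Lemma C1c_continuous a b phi : C1c a b phi -> continuous phi.
Proof.
move=> [dphi _ _ _] x.
by apply: differentiable_continuous; exact/derivable1_diffP.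
Qed.

Lemma C1c_out a b phi x : C1c a b phi -> ~~ (a < x < b) -> phi x = 0.
Proof.
move=> [_ _ _ H] xab; apply/eqP; apply: contraNT xab => p0.
by have := H x; rewrite /= in_itv/=; apply; apply: subset_closure.
Qed.

Lemma W1infty_derivD l k u v w z : 0 < l ->
  W1infty_deriv 0 l u v -> W1infty_deriv 0 l w z ->
  W1infty_deriv 0 l (fun x => u x + k * w x) (fun x => v x + k * z x).
Proof.
move=> l0 [uL vL uv] [wL zL wz].
have L f g : Linfty 0 l f -> Linfty 0 l g ->
    Linfty 0 l (fun x => f x + k * g x).
  move=> fL gL; rewrite /Linfty.
  have -> : (fun x => f x + k * g x) \_ `]0, l[ =
      (k *: (g \_ `]0, l[) + f \_ `]0, l[).
    apply/funext => x.
    transitivity (k * (g \_ `]0, l[) x + (f \_ `]0, l[) x) => //.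
    by rewrite !patchE; case: ifPn => // _; rewrite 1?addrC// mulr0 addr0.
  have p1 : (1 <= +oo :> \bar R)%E by rewrite leey.
  have [_] := @Lfun_submod_closed _ _ R mu +oo%E p1; apply; first exact: gL.
  exact: fL.
split; [exact: L|exact: L|move=> phi phiC].
have cphi := C1c_continuous phiC; have [_ cphi' _ _] := phiC.
have I f g : Linfty 0 l f -> continuous g ->
    mu.-integrable `]0, l[%classic (EFin \o (fun x => f x * g x)).
  by move=> fL cg; exact: Linfty_integrableM.
have E f g h : Linfty 0 l f -> Linfty 0 l g -> continuous h ->
    \int[mu]_(x in `]0, l[) ((f x + k * g x) * h x) =
    \int[mu]_(x in `]0, l[) (f x * h x) +
    k * \int[mu]_(x in `]0, l[) (g x * h x).
  move=> fL gL ch.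
  under eq_Rintegral do rewrite mulrDl -mulrA.
  rewrite RintegralD//; [|exact: I|].
    by rewrite RintegralZl//; exact: I.
  by apply: integrableZ_EFin => //; exact: I.
by rewrite !E// uv// wz//; ring.
Qed.

(** Integrating the derivative of (x - a) phi(x) over the part of ]0, l[ to the
    right of a leaves no boundary term: the factor x - a vanishes at a, and phi
    vanishes at 0 and at l. *)
Lemma ramp_by_parts a l phi : 0 < l -> C1c 0 l phi ->
  \int[mu]_(x in `]0, l[) (ramp a x * derive1 phi x) =
  - \int[mu]_(x in `]Num.max a 0, l[) phi x.
Proof.
move=> l0 phiC; set b := Num.max a 0.
have cphi := C1c_continuous phiC; have [dphi cphi' _ _] := phiC.
have b0 : 0 <= b by rewrite /b le_max lexx orbT.
have ab : a <= b by rewrite /b le_max lexx.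
transitivity (\int[mu]_(x in `]b, l[) ((x - a) * derive1 phi x)).
  rewrite Rintegral_mkcond [RHS]Rintegral_mkcond.
  apply: eq_Rintegral => x _; rewrite !patchE !mem_setE !in_itv/=.
  case: (ltP b x) => bx /=.
    rewrite (_ : 0 < x)/=; last by lra.
    by case: ifP => //= _; rewrite rampR//; lra.
  case: ifP => //= /andP[x0 xl]; rewrite rampL ?mul0r//.
  by move: bx; rewrite /b le_max (leNgt x 0) x0 orbF.
have [bl|lb] := ltP b l; last first.
  rewrite !set_itv_ge ?bnd_simp -?leNgt//.
  by rewrite !Rintegral_set0 oppr0.
have cx : continuous (fun x : R => x - a).
  by move=> x; apply: cvgB; [exact: cvg_id|exact: cvg_cst].
have c1 : continuous (fun x : R => (x - a) * derive1 phi x).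
  by move=> x; apply: cvgM; [exact: cx|exact: cphi'].
have cs : continuous (fun x : R => (x - a) * derive1 phi x + phi x).
  by move=> x; apply: cvgD; [exact: c1|exact: cphi].
apply/eqP; rewrite -addr_eq0 -RintegralD//; [|exact: continuous_integrable..].
rewrite Rintegral_itv_obnd_cbnd; last exact: continuous_integrable.
rewrite Rintegral_itv_bndo_bndc; last first.
  apply: (@integrableS _ _ _ mu `[b, l]%classic) => //.
    by move=> x /=; rewrite !in_itv/= => /andP[-> /ltW].
  apply: continuous_compact_integrable; first exact: segment_compact.
  exact: continuous_subspaceT.
have dF (x : R) : is_derive x (1 : R) (fun x : R => (x - a) * phi x)
                      ((x - a) * derive1 phi x + phi x).
  have dp : is_derive x (1 : R) phi (derive1 phi x).
    by rewrite derive1E; exact/derivableP.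
  apply: is_derive_eq; rewrite /GRing.scale/= subr0 mulr1; ring.
have cF : continuous (fun x : R => (x - a) * phi x).
  by move=> x; apply: cvgM; [exact: cx|exact: cphi].
rewrite /Rintegral (@continuous_FTC2 _ _ (fun x : R => (x - a) * phi x))//.
- rewrite -EFinB /= (C1c_out phiC (x := l)) ?ltxx ?andbF// mulr0 sub0r.
  rewrite oppr_eq0; apply/eqP.
  have [->|bn0] := eqVneq b 0.
    by rewrite (C1c_out phiC (x := 0)) ?ltxx// mulr0.
  suff -> : b = a by rewrite subrr mul0r.
  by move: bn0; rewrite /b /Num.max; case: ltP => // _; rewrite eqxx.
- exact: continuous_subspaceT.
- split=> [x _||]; first by have [] := dF x.
  + by apply: cvg_at_right_filter; exact: cF.
  + by apply: cvg_at_left_filter; exact: cF.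
- by move=> x _; rewrite derive1E; apply: derive_val.
Qed.

End WeakDerivative.

(** * The weak derivative of a profile *)

Section ProfileDerivative.
Variable R : realType.
Implicit Types (a b l d lam Lam : R) (u v w phi : R -> R) (s : seq R).
Local Notation mu := (@lebesgue_measure R).

Lemma W1infty_deriv_eq l u v w : (forall x, 0 < x < l -> v x = w x) ->
  W1infty_deriv 0 l u v -> W1infty_deriv 0 l u w.
Proof.
move=> vw [uL vL uv].
have vwE : v \_ `]0, l[ = w \_ `]0, l[.
  apply/funext => x; rewrite !patchE; case: ifPn => //.
  by rewrite inE/= in_itv/= => /vw.
split => //; first by rewrite /Linfty -vwE.
move=> phi phiC; rewrite uv//; congr (- _); apply: eq_Rintegral => x.
by rewrite inE/= in_itv/= => /vw ->.
Qed.

Lemma measurable_gt a (D : set R) :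
  measurable_fun D (fun x : R => (a < x)%R%:R : R).
Proof.
apply: (@measurable_funS _ _ _ _ setT) => //.
rewrite (_ : (fun x : R => _) = \1_(`]a, +oo[%classic)); first exact: measurable_indic.
by apply/funext => x; rewrite indicE mem_setE in_itv/= andbT.
Qed.

Lemma measurable_ge a (D : set R) :
  measurable_fun D (fun x : R => (a <= x)%R%:R : R).
Proof.
apply: (@measurable_funS _ _ _ _ setT) => //.
rewrite (_ : (fun x : R => _) = \1_(`[a, +oo[%classic)); first exact: measurable_indic.
by apply/funext => x; rewrite indicE mem_setE in_itv/= andbT.
Qed.

Lemma Linfty_ramp a l : 0 < l -> Linfty 0 l (ramp a).
Proof.
move=> l0; apply: (@bounded_Linfty _ _ _ (l + `|a|)).
  apply: (@measurable_funS _ _ _ _ setT) => //.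
  by apply: continuous_measurable_fun; exact: continuous_ramp.
move=> x /andP[x0 xl]; rewrite ger0_norm ?ramp_ge0//.
have := ler_norm (- a); rewrite normrN; have := normr_ge0 a.
by case: rampP => *; lra.
Qed.

Lemma W1infty_deriv_ramp_gt a l : 0 < l ->
  W1infty_deriv 0 l (ramp a) (fun x => (a < x)%R%:R).
Proof.
move=> l0; split; first exact: Linfty_ramp.
  apply: (@bounded_Linfty _ _ _ 1); first exact: measurable_gt.
  by move=> x _; case: (a < x); rewrite ?normr0 ?normr1.
move=> phi phiC; rewrite ramp_by_parts//; congr (- _).
rewrite Rintegral_mkcond [RHS]Rintegral_mkcond; apply: eq_Rintegral => x _.
rewrite !patchE !mem_setE !in_itv/= gt_max.
by case: (a < x); case: (0 < x); case: (x < l) => /=; rewrite ?mul1r ?mul0r.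
Qed.

(** The value of the derivative at the kink is immaterial. Combined with
    [W1infty_deriv_ramp_gt], this choice makes the weak derivative of an overlap
    equal everywhere to the indicator function of an open interval. *)
Lemma W1infty_deriv_ramp_ge a l : 0 < l ->
  W1infty_deriv 0 l (ramp a) (fun x => (a <= x)%R%:R).
Proof.
move=> l0; split; first exact: Linfty_ramp.
  apply: (@bounded_Linfty _ _ _ 1); first exact: measurable_ge.
  by move=> x _; case: (a <= x); rewrite ?normr0 ?normr1.
move=> phi phiC; have [_ _ -> //] := W1infty_deriv_ramp_gt a l0.
congr (- _); rewrite /Rintegral; congr fine.
have mphi : measurable_fun (`]0, l[%classic : set R) phi.
  apply: (@measurable_funS _ _ _ _ setT) => //.
  by apply: continuous_measurable_fun; exact: (C1c_continuous phiC).
apply: ae_eq_integral => //.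
- by apply/measurable_EFinP; apply: measurable_funM => //; exact: measurable_gt.
- by apply/measurable_EFinP; apply: measurable_funM => //; exact: measurable_ge.
exists [set a]; split => //; first exact: lebesgue_measure_set1.
move=> x /= nx; apply: contrapT => /eqP xa; apply: nx => _.
by rewrite le_eqVlt eq_sym (negbTE xa).
Qed.

Lemma W1infty_deriv_profile d l lam Lam s : 0 < l ->
  W1infty_deriv 0 l (profile lam Lam d s)
    (fun x => lam * (0 < x)%R%:R - (Lam + lam) *
       \sum_(p <- s) ((p - d / 2 < x)%R%:R - (p + d / 2 <= x)%R%:R)).
Proof.
move=> l0; elim: s => [|p s IH].
  have := W1infty_derivD (lam - 1) l0 (W1infty_deriv_ramp_gt 0 l0)
                                     (W1infty_deriv_ramp_gt 0 l0).
  congr W1infty_deriv; apply/funext => x.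
    by rewrite /profile big_nil; ring.
  by rewrite big_nil; ring.
have bp := W1infty_derivD (-1) l0 (W1infty_deriv_ramp_gt (p - d / 2) l0)
                                 (W1infty_deriv_ramp_ge (p + d / 2) l0).
have := W1infty_derivD (- (Lam + lam)) l0 IH bp.
congr W1infty_deriv; apply/funext => x.
  rewrite /profile big_cons [overlap d p x]/overlap; set S := \sum_(_ <- _) _; ring.
rewrite big_cons; set S := \sum_(_ <- _) _; ring.
Qed.

Lemma W1infty_deriv_slope d l lam Lam (X : set R) : 0 < l -> 0 < d ->
  finite_set X ->
  W1infty_deriv 0 l (profile lam Lam d (enum_fset (fset_set X))) (slope lam Lam d l X).
Proof.
move=> l0 d0 finX.
apply: W1infty_deriv_eq (W1infty_deriv_profile d lam Lam (enum_fset (fset_set X)) l0).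
move=> x x0l; have /andP[x0 xl] := x0l.
rewrite x0 mulr1 /slope indicE mem_setE in_itv/= x0l mul1r fsbig_finite//.
congr (_ - _ * _); apply: eq_bigr => p _.
rewrite indicE mem_setE in_itv/=.
case: (ltP (p - d / 2) x) => ? /=; case: (ltP x (p + d / 2)) => ? /=;
  rewrite ?subrr ?subr0//; lra.
Qed.

End ProfileDerivative.

(** * Functions with zero weak derivative *)

Section DuBoisReymond.
Variable R : realType.
Implicit Types (a b l : R) (u v w phi : R -> R).
Local Notation mu := (@lebesgue_measure R).

(* Lagrange basis polynomials, in a, for the nodes l / 4, l / 2 and 3 l / 4 *)
Let L1 l a : R := 8 * (a / l - 1 / 2) * (a / l - 3 / 4).
Let L2 l a : R := - 16 * (a / l - 1 / 4) * (a / l - 3 / 4).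
Let L3 l a : R := 8 * (a / l - 1 / 4) * (a / l - 1 / 2).

(* Quadratic polynomials equal their interpolants at three nodes; applied to
   a |-> (x - a)^2 / 2, this makes the probe vanish to the right of its kinks,
   so that it is a test function. *)
Let probe l a x : R := qramp a x - L1 l a * qramp (l / 4) x
  - L2 l a * qramp (l / 2) x - L3 l a * qramp (3 * l / 4) x.

Let dprobe l a x : R := ramp a x - L1 l a * ramp (l / 4) x
  - L2 l a * ramp (l / 2) x - L3 l a * ramp (3 * l / 4) x.

Let is_derive_probe l a x : is_derive x (1 : R) (probe l a) (dprobe l a x).
Proof.
have Z k b : is_derive x (1 : R) (fun x => k * qramp b x) (k * ramp b x).
  have H := is_derive_qramp b x.
  exact: (@is_deriveZ _ _ _ (qramp b) k x 1 _ H).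
have H := is_derive_qramp a x.
by apply: is_deriveB.
Qed.

Let derive1_probe l a : derive1 (probe l a) = dprobe l a.
Proof.
apply/funext => x; rewrite derive1E.
by have [_ ->] := is_derive_probe l a x.
Qed.

Let C1c_probe l a : 0 < a < l -> C1c 0 l (probe l a).
Proof.
move=> /andP[a0 al]; have l0 : 0 < l by lra.
pose m := Num.min a (l / 4); pose M := Num.max a (3 * l / 4).
have ma : m <= a by rewrite /m ge_min lexx.
have ml : m <= l / 4 by rewrite /m ge_min lexx orbT.
have Ma : a <= M by rewrite /M le_max lexx.
have Ml : 3 * l / 4 <= M by rewrite /M le_max lexx orbT.
have m0 : 0 < m by rewrite /m lt_min; lra.
have Mll : M < l by rewrite /M gt_max; lra.
have supp : closure [set x | probe l a x != 0] `<=` `[m, M].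
  rewrite (_ : `[m, M]%classic = closure `[m, M]); last first.
    by apply/closure_id; exact: itv_closed.
  apply: closure_subset => x /= pn0; rewrite in_itv/=.
  apply: contraNT pn0; rewrite negb_and -!ltNge => /orP[xm|Mx].
    by rewrite /probe /qramp !rampL ?expr0n/=; [apply/eqP; ring|lra..].
  rewrite /probe /qramp !rampR; [|lra..].
  rewrite /L1 /L2 /L3; apply/eqP; field; lra.
split.
- by move=> x; have [] := is_derive_probe l a x.
- rewrite derive1_probe => x.
  have Z k b : {for x, continuous (fun x => k * ramp b x)}.
    by apply: cvgM; [exact: cvg_cst|exact: continuous_ramp].
  by do 3 (apply: cvgB; last exact: Z); exact: continuous_ramp.
- apply: (subclosed_compact _ (@segment_compact _ m M) supp).
  exact: closed_closure.
- apply: (subset_trans supp) => x /=; rewrite !in_itv/= => /andP[? ?].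
  by apply/andP; split; lra.
Qed.

(** The test function [probe l a] expresses the moment of w against the ramp at
    a through the moments at the three nodes, with coefficients that are
    quadratic in a. *)
Let moment_quadratic l w : 0 < l -> W1infty_deriv 0 l w (cst 0) ->
  exists A B C : R, forall a, 0 < a < l ->
   \int[mu]_(x in `]0, l[) (w x * ramp a x) = A + B * a + C * a ^+ 2.
Proof.
move=> l0 [wL _ w0]; pose G a := \int[mu]_(x in `]0, l[) (w x * ramp a x).
have I a : mu.-integrable `]0, l[%classic (EFin \o (fun x => w x * ramp a x)).
  by apply: Linfty_integrableM => //; exact: continuous_ramp.
have IZ k a : mu.-integrable `]0, l[%classic
    (EFin \o (fun x => k * (w x * ramp a x))).
  by apply: integrableZ_EFin => //; exact: I.
have IB f g := @integrableB_EFin R `]0, l[%classic f g (measurable_itv _).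
have key a : 0 < a < l ->
    G a = L1 l a * G (l / 4) + L2 l a * G (l / 2) + L3 l a * G (3 * l / 4).
  move=> a0l; have := w0 _ (C1c_probe a0l).
  have -> : \int[mu]_(x in `]0, l[) (cst 0 x * probe l a x) = 0.
    under eq_Rintegral do rewrite /= mul0r.
    by rewrite Rintegral_cst//= mul0r.
  rewrite derive1_probe /dprobe.
  under eq_Rintegral.
    move=> x _.
    rewrite !mulrBr !(mulrCA (w x)).
    over.
  rewrite !RintegralB//; [|exact: (IB _ _ (I _) (IZ _ _))|].
    2: exact: (IB _ _ (IB _ _ (I _) (IZ _ _)) (IZ _ _)).
  rewrite !RintegralZl//.
  rewrite oppr0 -/(G a) -/(G _) -/(G (l / 2)) -/(G (3 * l / 4)).
  by move=> H; lra.
exists (3 * G (l / 4) - 3 * G (l / 2) + G (3 * l / 4)).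
exists ((- 10 * G (l / 4) + 16 * G (l / 2) - 6 * G (3 * l / 4)) / l).
exists ((8 * G (l / 4) - 16 * G (l / 2) + 8 * G (3 * l / 4)) / l ^+ 2).
move=> a a0l; rewrite -/(G a) key// /L1 /L2 /L3; field; lra.
Qed.

(** The difference of the ramps at a and a + h equals h times the indicator
    function of ]a, +oo[, except on ]a, a + h], where it is off by at most h. *)
Let ramp_slope_estimate l w M a h : 0 < l -> Linfty 0 l w -> 0 <= M ->
  {ae mu, forall x, `]0, l[%classic x -> `|w x| <= M} -> 0 < h ->
  `|\int[mu]_(x in `]0, l[) (w x * ramp a x)
    - \int[mu]_(x in `]0, l[) (w x * ramp (a + h) x)
    - h * \int[mu]_(x in `]0, l[) (w x * (a < x)%R%:R)| <= M * h ^+ 2.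
Proof.
move=> l0 wL M0 wM h0.
pose k x := ramp a x - ramp (a + h) x - h * (a < x)%R%:R.
have kE x : `|k x| <= h * \1_(`]a, a + h[%classic) x.
  rewrite /k indicE mem_setE in_itv/=.
  case: (ltP a x) => ax /=; case: (ltP x (a + h)) => xh /=;
  rewrite ?mulr0 ?mulr1 ler_norml; do 2 case: rampP => ?; lra.
have I c : mu.-integrable `]0, l[%classic (EFin \o (fun x => w x * ramp c x)).
  by apply: Linfty_integrableM => //; exact: continuous_ramp.
have J : mu.-integrable `]0, l[%classic (EFin \o (fun x => w x * (a < x)%R%:R)).
  apply: (@Linfty_integrable_bounded _ _ _ 1) => //; first exact: measurable_gt.
  by move=> x _; case: (a < x); rewrite ?normr0 ?normr1.
have hJ : mu.-integrable `]0, l[%classic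
    (EFin \o (fun x => h * (w x * (a < x)%R%:R))).
  exact: integrableZ_EFin.
have IB f g := @integrableB_EFin R `]0, l[%classic f g (measurable_itv _).
have -> : \int[mu]_(x in `]0, l[) (w x * ramp a x)
    - \int[mu]_(x in `]0, l[) (w x * ramp (a + h) x)
    - h * \int[mu]_(x in `]0, l[) (w x * (a < x)%R%:R) =
    \int[mu]_(x in `]0, l[) (w x * k x).
  rewrite -RintegralZl// -RintegralB// -RintegralB//; last exact: IB.
  by apply: eq_Rintegral => x _; rewrite /k; ring.
have Ik : mu.-integrable `]0, l[%classic (EFin \o (fun x => w x * k x)).
  rewrite (_ : (fun x => _) = (fun x => w x * ramp a x - w x * ramp (a + h) x
      - h * (w x * (a < x)%R%:R))); first exact: (IB _ _ (IB _ _ (I _) (I _)) hJ).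
  by apply/funext => x; rewrite /k; ring.
apply: le_trans; first exact: le_normr_Rintegral.
rewrite -lee_fin /Rintegral fineK; last first.
  apply: integrable_fin_num => //.
  by have := integrable_norm Ik.
have m1 : measurable_fun (`]0, l[%classic : set R)
    (fun x => (\1_(`]a, a + h[%classic) x)%:E : \bar R).
  by apply/measurable_EFinP; exact: measurable_indic.
apply: (@le_trans _ _ (\int[mu]_(x in `]0%R, l[)
    ((M * h)%:E * (\1_(`]a, (a + h)%R[%classic) x)%:E))%E).
  have mw := measurable_int mu Ik.
  apply: ae_ge0_le_integral => //.
  - by apply/measurable_EFinP; apply: measurableT_comp => //; exact/measurable_EFinP.
  - by move=> x _; rewrite -EFinM lee_fin mulr_ge0// mulr_ge0// ltW.
  - exact: measurable_funeM.
  - apply: ae_imp wM => x wM xl; rewrite -EFinM lee_fin normrM -mulrA.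
    by apply: ler_pM => //; exact: wM.
rewrite ge0_integralZl//; last by rewrite lee_fin mulr_ge0// ltW.
rewrite integral_indic// expr2 mulrA [leRHS]EFinM; apply: lee_wpmul2l.
  by rewrite lee_fin mulr_ge0// ltW.
apply: (@le_trans _ _ (mu `]a, a + h[%classic)).
  by apply: le_measure; rewrite ?inE//; exact: measurableI.
rewrite lebesgue_measure_itv/= lte_fin ltrDl h0 -EFinB lee_fin; lra.
Qed.

(** By [ramp_slope_estimate] the integral of w over ]a, l[ is minus the
    derivative in a of the moment against the ramp at a, a quadratic
    polynomial. *)
Let tail_affine l w : 0 < l -> W1infty_deriv 0 l w (cst 0) ->
  exists B C : R, forall a, 0 < a < l ->
   \int[mu]_(x in `]0, l[) (w x * (a < x)%R%:R) = B + C * a.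
Proof.
move=> l0 wW; have [wL _ _] := wW; have [M M0 wM] := Linfty_bounded wL.
have [A [B [C G]]] := moment_quadratic l0 wW.
exists (- B), (- 2 * C) => a /andP[a0 al].
set H := \int[mu]_(_ in _) _; apply/eqP; rewrite -subr_eq0 -normr_le0.
apply/ler_addgt0Pr => e e0; rewrite add0r.
pose h := Num.min ((l - a) / 2) (e / (M + `|C| + 1)).
have MC : 0 < M + `|C| + 1 by rewrite ltr_wpDl// addr_ge0.
have h0 : 0 < h by rewrite lt_min !divr_gt0// subr_gt0.
have hl : h <= (l - a) / 2 by rewrite ge_min lexx.
have he : h * (M + `|C| + 1) <= e.
  by rewrite -ler_pdivlMr// ge_min lexx orbT.
have := ramp_slope_estimate a l0 wL M0 wM h0.
rewrite !G -?/H; [|lra..].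
rewrite !ler_norml; have := ler_norm C; have := ler_norm (- C); rewrite normrN.
move=> C1 C2 /andP[k1 k2]; apply/andP; split.
  rewrite -(ler_pM2l h0); nra.
rewrite -(ler_pM2l h0); nra.
Qed.

(** The integral of w over ]a, l[ is affine in a, and Lebesgue's differentiation
    theorem recovers w almost everywhere as minus its derivative. *)
Lemma W1infty_deriv0_ae_cst l w : 0 < l -> W1infty_deriv 0 l w (cst 0) ->
  exists c : R, {ae mu, forall x, `]0, l[%classic x -> w x = c}.
Proof.
move=> l0 wW; have [wL _ _] := wW; have [B [C H]] := tail_affine l0 wW.
exists (- C); set w' := w \_ `]0, l[.
have Iw : mu.-integrable `]0, l[%classic (EFin \o w).
  have : mu.-integrable `]0, l[%classic (fun x => (w x * cst 1 x)%:E).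
    by apply: Linfty_integrableM => //; exact: cst_continuous.
  by apply: eq_integrable => // x _; rewrite /= mulr1.
have Iw' : mu.-integrable [set: R] (EFin \o w').
  by rewrite /w' -restrict_EFin; apply/(integrable_mkcond _ _).1.
have Iw'S (D : set R) : measurable D -> mu.-integrable D (EFin \o w').
  by move=> mD; apply: (@integrableS _ _ _ mu setT).
have loc : locally_integrable [set: R] w' by exact: integrable_locally.
have := @FTC1 R w' (BRight 0) (fun y => Iw'S _ (measurable_itv _)) loc.
apply: ae_imp => x /= + xl; move: (xl); rewrite /= in_itv/= => /andP[x0 xltl].
move=> /(_ x0)[dF dFx].
have w'x : w' x = w x by rewrite /w' patchE mem_set.
rewrite -w'x -dFx derive1E.
set T := \int[mu]_(t in `]0, l[) w' t.
have FE y : 0 < y < l -> \int[mu]_(t in `]0, y]) w' t = T - B - C * y.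
  move=> /andP[y0 yl].
  have := @Rintegral_itvB R w' (BRight 0) (BLeft l) y (Iw'S _ (measurable_itv _)).
  rewrite !bnd_simp ltW// => /(_ isT yl).
  have -> : \int[mu]_(t in `]y, l[) w' t =
            \int[mu]_(t in `]0, l[) (w t * (y < t)%R%:R).
    rewrite Rintegral_mkcond [RHS]Rintegral_mkcond; apply: eq_Rintegral => t _.
    rewrite /w' !patchE !mem_setE !in_itv/=.
    case: (ltP y t) => yt; case: (ltP t l) => tl;
      case: (ltP 0 t) => t0; rewrite /= ?mulr1 ?mulr0//; lra.
  by rewrite H ?y0// -/T; lra.
have -> : (fun x => \int[mu]_(t in [set` Interval (BRight 0) (BRight x)]) w' t)
   = (fun y => \int[mu]_(t in `]0, y]) w' t) by [].
rewrite (@near_eq_derive _ _ _ _ (fun y : R => T - B - C * y)); last first.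
- near=> y; apply: FE; near: y; apply: near_in_itvoo.
  by rewrite in_itv/= x0.
have D : is_derive x (1 : R) (fun y : R => C * y) C.
  have := @is_deriveZ _ _ _ (@id R) C x 1 1 (is_derive_id _ _).
  by rewrite /GRing.scale/= mulr1.
have D' : is_derive x (1 : R) (fun y : R => T - B - C * y) (0 - C).
  by apply: is_deriveB.
by rewrite (@derive_val _ _ _ _ _ _ _ D') sub0r.
Unshelve. all: by end_near. Qed.

Lemma W1infty_deriv_unique l u w v : 0 < l ->
  W1infty_deriv 0 l u v -> W1infty_deriv 0 l w v ->
  exists c : R, {ae mu, forall x, `]0, l[%classic x -> u x = w x + c}.
Proof.
move=> l0 uv wv; have := W1infty_derivD (-1) l0 uv wv.
rewrite (_ : (fun x => v x + _) = cst 0); last first.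
  by apply/funext => x /=; ring.
move=> /(W1infty_deriv0_ae_cst l0)[c uc]; exists c.
by apply: ae_imp uc => x /[apply] <-; ring.
Qed.

End DuBoisReymond.

(** * Double integrals of squared difference quotients *)

Definition chord (R : realType) (u : R -> R) (z : R * R) : R :=
  `|u z.1 - u z.2| ^+ 2 / `|z.1 - z.2| ^+ 2.

Definition dint (R : realType) (A B : set R) (f : R * R -> R) : \bar R :=
  (\int[@lebesgue_measure R]_(x in A) \int[@lebesgue_measure R]_(y in B)
    (f (x, y))%:E)%E.

(** The squared Gagliardo seminorm of the space W^{1/2,2}(0, l). *)
Definition gagliardo (R : realType) (l : R) (u : R -> R) : \bar R :=
  dint `]0, l[%classic `]0, l[%classic (chord u).

Section DoubleIntegral.
Variable R : realType.
Implicit Types (A B : set R) (u v w : R -> R).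
Local Notation mu := (@lebesgue_measure R).
Local Notation T := (measurableTypeR R).

Lemma inner_integral_measurable A B (f : T * T -> R) : measurable B ->
  measurable_fun [set: T * T] f -> (forall z, 0 <= f z) ->
  measurable_fun A (fun x : T => (\int[mu]_(y in B) (f (x, y))%:E)%E).
Proof.
move=> mB mf f0; apply: (@measurable_funS _ _ _ _ setT) => //.
pose g : T * T -> \bar R := (EFin \o f) \_ (setT `*` B).
have mg : measurable_fun [set: T * T] g.
  apply/(measurable_restrictT _ _).1; first exact: measurableX.
  by apply/measurable_EFinP; exact: measurable_funS mf.
have g0 z : (0 <= g z)%E.
  by apply: erestrict_ge0 => ? _; rewrite lee_fin.
have := @measurable_fun_fubini_tonelli_F _ _ T T R mu g mg g0.
congr measurable_fun; apply/funext => x; rewrite /fubini_F [RHS]integral_mkcond.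
apply: eq_integral => y _; rewrite /g !patchE.
congr (if _ then _ else _); apply/idP/idP; rewrite !inE/=; first by case.
by split.
Qed.

(** By Tonelli's theorem; over the product measure, monotonicity and additivity
    become those of a single integral. *)
Lemma dintE A B (f : T * T -> R) : measurable A -> measurable B ->
  measurable_fun [set: T * T] f -> (forall z, 0 <= f z) ->
  dint A B f = (\int[mu \x mu]_(z in A `*` B) (f z)%:E)%E.
Proof.
move=> mA mB mf f0; have mAB : measurable (A `*` B) by exact: measurableX.
rewrite [RHS]integral_mkcond fubini_tonelli1//; last 2 first.
- apply/(measurable_restrictT _ _).1 => //.
  by apply/measurable_EFinP; exact: measurable_funS mf.
- by move=> z; apply: erestrict_ge0 => ? _; rewrite lee_fin.
rewrite /dint integral_mkcond; apply: eq_integral => x _.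
rewrite /fubini_F patchE; case: ifPn => [xA|xA].
  rewrite [LHS]integral_mkcond; apply: eq_integral => y _; rewrite !patchE.
  congr (if _ then _ else _); apply/idP/idP; rewrite !inE/=; last by case.
  by split => //; rewrite inE in xA.
apply/esym/integral0_eq => y _; rewrite patchE; case: ifPn => //.
by rewrite inE/= => -[xA' _]; rewrite mem_set in xA.
Qed.

Lemma chord_ge0 u z : 0 <= chord u z.
Proof. by rewrite /chord divr_ge0 ?exprn_ge0. Qed.

Lemma measurable_chord (u : T -> R) : measurable_fun [set: T] u ->
  measurable_fun [set: T * T] (chord u).
Proof.
move=> mu_.
have m1 : measurable_fun [set: T * T] (fun z : T * T => `|u z.1 - u z.2| ^+ 2).
  apply: measurable_funX; apply: measurableT_comp => //.
  by apply: measurable_funB; apply: measurableT_comp.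
have m2 : measurable_fun [set: T * T] (fun z : T * T => (`|z.1 - z.2| ^+ 2)^-1).
  (* the inverse of a nonnegative number is its power of exponent -1 *)
  rewrite (_ : (fun _ => _) =
      (@powR R ^~ (-1)) \o (fun z : T * T => `|z.1 - z.2| ^+ 2)); last first.
    by apply/funext => z /=; rewrite powR_inv1// exprn_ge0.
  apply: (measurableT_comp (measurable_powR (-1))) => //.
  apply: measurable_funX; apply: measurableT_comp => //.
  exact: measurable_funB.
exact: measurable_funM.
Qed.

Lemma energyE l u : energy l u = ((l^-1)%:E * gagliardo l u)%E.
Proof. by []. Qed.

Lemma dint_ge0 A B (f : T * T -> R) : (forall z, 0 <= f z) -> (0 <= dint A B f)%E.
Proof. by move=> f0; do 2 (apply: integral_ge0 => ? _); rewrite lee_fin. Qed.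

Lemma eq_dint A B (f g : T * T -> R) :
  (forall x y, A x -> B y -> f (x, y) = g (x, y)) -> dint A B f = dint A B g.
Proof.
move=> fg; apply: eq_integral => x /set_mem Ax.
by apply: eq_integral => y /set_mem By; rewrite fg.
Qed.

Lemma le_dint A B (f g : T * T -> R) : measurable A -> measurable B ->
  measurable_fun [set: T * T] f -> measurable_fun [set: T * T] g ->
  (forall z, 0 <= f z) -> (forall z, 0 <= g z) ->
  (forall x y, A x -> B y -> f (x, y) <= g (x, y)) ->
  (dint A B f <= dint A B g)%E.
Proof.
move=> mA mB mf mg f0 g0 fg; rewrite !dintE//.
have mAB : measurable (A `*` B) by exact: measurableX.
apply: ge0_le_integral => //.
- by move=> z _; rewrite lee_fin.
- by apply/measurable_EFinP; exact: measurable_funS mf.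
- by apply/measurable_EFinP; exact: measurable_funS mg.
- by move=> [x y] [Ax By]; rewrite lee_fin fg.
Qed.

Lemma dintD A B (f g : T * T -> R) : measurable A -> measurable B ->
  measurable_fun [set: T * T] f -> measurable_fun [set: T * T] g ->
  (forall z, 0 <= f z) -> (forall z, 0 <= g z) ->
  dint A B (fun z => f z + g z) = (dint A B f + dint A B g)%E.
Proof.
move=> mA mB mf mg f0 g0; rewrite !dintE//.
- rewrite -ge0_integralD//.
  + exact: measurableX.
  + by move=> z _; rewrite lee_fin.
  + by apply/measurable_EFinP; exact: measurable_funS mf.
  + by move=> z _; rewrite lee_fin.
  + by apply/measurable_EFinP; exact: measurable_funS mg.
- exact: measurable_funD.
- by move=> z; rewrite addr_ge0.
Qed.

Lemma dint_cst (a b c e k : R) : a <= b -> c <= e ->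
  dint `]a, b[ `]c, e[ (cst k) = (k * (e - c) * (b - a))%:E.
Proof.
move=> ab ce; rewrite /dint.
have mI (x y : R) : x <= y -> mu `]x, y[%classic = (y - x)%:E.
  move=> xy; rewrite lebesgue_measure_itv/= lte_fin.
  by case: ltgtP xy => // -> _; rewrite subrr.
have E (x y r : R) : x <= y -> (\int[mu]_(_ in `]x, y[) r%:E = (r * (y - x))%:E)%E.
  move=> xy; have := @integral_cst _ _ _ mu `]x, y[%classic (measurable_itv _) r%:E.
  by move=> /= ->; rewrite [X in (_ * X)%E](mI _ _ xy) -EFinM.
by under eq_integral do rewrite E//; rewrite E.
Qed.

(** The weak derivative fixes a function only up to a null set and an additive
    constant; the double integral sees neither. *)
Lemma gagliardo_ae l c u w : Linfty 0 l u -> measurable_fun [set: T] w ->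
  {ae mu, forall x, `]0, l[%classic x -> u x = w x + c} ->
  gagliardo l u = gagliardo l w.
Proof.
move=> uL mw uw; pose u' := u \_ `]0, l[.
have mu' : measurable_fun [set: T] u' by exact: Linfty_measurable.
have -> : gagliardo l u = gagliardo l u'.
  apply: eq_dint => x y xl yl; rewrite /chord /u' /= !patchE !mem_set//.
rewrite /gagliardo /dint; apply: ae_eq_integral => //.
- apply: inner_integral_measurable => //; last exact: chord_ge0.
  exact: measurable_chord.
- apply: inner_integral_measurable => //; last exact: chord_ge0.
  exact: measurable_chord.
have sec v x : measurable_fun [set: T] v ->
    measurable_fun (`]0, l[%classic : set T) (fun y => (chord v (x, y))%:E).
  move=> mv; apply/measurable_EFinP; apply: (@measurable_funS _ _ _ _ setT) => //.
  apply: (measurableT_comp (measurable_chord mv) (g := fun y => (x, y))).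
  exact: pair1_measurable.
apply: ae_imp (uw) => x uwx xl; apply: ae_eq_integral => //; try exact: sec.
move: uw; apply: ae_imp => y uwy yl; congr EFin.
rewrite /chord /= /u' !patchE !mem_set// uwx// uwy//.
by congr (`|_| ^+ 2 / _); ring.
Qed.

End DoubleIntegral.

(** * Upper bounds for the double integral *)

Section GagliardoBounds.
Variable R : realType.
Implicit Types (l k e L B h : R) (u w : R -> R).
Local Notation mu := (@lebesgue_measure R).
Local Notation T := (measurableTypeR R).

(* A multiple of the Cauchy kernel at scale e. It has an elementary
   antiderivative in either variable and is integrable over the line. *)
Let cauchy k e (z : R * R) : R := k / (e ^+ 2 + (z.1 - z.2) ^+ 2).

Let cauchy_den e t : 0 < e -> 0 < e ^+ 2 + t ^+ 2 :> R.
Proof. by move=> e0; rewrite ltr_pwDl ?exprn_gt0 ?sqr_ge0. Qed.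

Let cauchy_ge0 k e z : 0 <= k -> 0 < e -> 0 <= cauchy k e z.
Proof. by move=> k0 e0; rewrite divr_ge0// ltW// cauchy_den. Qed.

Let cauchy_section_continuous k e (x : R) : 0 < e ->
  continuous (fun y : R => cauchy k e (x, y)).
Proof.
move=> e0 y; apply: cvgM; first exact: cvg_cst.
apply: cvgV; first by rewrite gt_eqF// cauchy_den.
apply: cvgD; first exact: cvg_cst.
have cxy : {for y, continuous (fun y : R => x - y)}.
  by apply: cvgB; [exact: cvg_cst|exact: cvg_id].
by rewrite expr2; apply: cvgM; exact: cxy.
Qed.

Let measurable_cauchy k e : 0 < e -> measurable_fun [set: T * T] (cauchy k e).
Proof.
move=> e0; apply: measurable_funM => //.
rewrite (_ : (fun _ => _) =
  (@powR R ^~ (-1)) \o (fun z : T * T => e ^+ 2 + (z.1 - z.2) ^+ 2)); last first.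
  by apply/funext => z /=; rewrite powR_inv1// ltW// cauchy_den.
apply: (measurableT_comp (measurable_powR (-1))) => //.
apply: measurable_funD => //.
by apply: measurable_funX; exact: measurable_funB.
Qed.

Let inner_cauchy l k e (x : R) : 0 < l -> 0 <= k -> 0 < e ->
  (\int[mu]_(y in `]0%R, l[) (cauchy k e (x, y))%:E <= (k / e * pi)%:E)%E.
Proof.
move=> l0 k0 e0.
have cc : continuous (fun y : R => cauchy k e (x, y)).
  exact: cauchy_section_continuous.
have mc D : measurable_fun D (fun y : T => (cauchy k e (x, y))%:E).
  apply/measurable_EFinP; apply: (@measurable_funS _ _ _ _ setT) => //.
  exact: continuous_measurable_fun.
rewrite integral_itv_obnd_cbnd; last exact: mc.
rewrite integral_itv_bndo_bndc; last exact: mc.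
(* an antiderivative of the kernel in y *)
pose F y := - (k / e) * atan ((x - y) / e).
have dF (y : R) : is_derive y (1 : R) F (cauchy k e (x, y)).
  have d1 : is_derive y (1 : R) (fun y : R => (x - y) / e) (- e^-1).
    have -> : (fun y : R => (x - y) / e) = (fun y => x / e - e^-1 * y).
      by apply/funext => t; ring.
    have d2 : is_derive y (1 : R) (fun y : R => e^-1 * y) e^-1.
      have := @is_deriveZ _ _ _ (@id R) e^-1 y 1 1 (is_derive_id _ _).
      by rewrite /GRing.scale/= mulr1.
    rewrite -[- e^-1]sub0r; exact: is_deriveB.
  have d3 := @is_derive1_comp _ (@atan R) (fun y : R => (x - y) / e) y _ _
    (is_derive1_atan _) d1.
  have := @is_deriveZ _ _ _ _ (- (k / e)) y 1 _ d3.
  rewrite /GRing.scale/= => H; apply: is_derive_eq H _.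
  rewrite /cauchy/=; have := cauchy_den (x - y) e0 => den.
  by field; rewrite (gt_eqF e0) (gt_eqF den).
have cF : continuous F.
  move=> y; apply: differentiable_continuous; apply/derivable1_diffP.
  by have [] := dF y.
rewrite (@continuous_FTC2 _ _ F)//.
- rewrite -EFinB lee_fin /F subr0.
  have := atan_gtNpi2 ((x - l) / e); have := atan_ltpi2 (x / e).
  have : 0 <= k / e by rewrite divr_ge0// ltW.
  set q := k / e; nra.
- exact: continuous_subspaceT.
- split=> [y _||]; first by have [] := dF y.
  + by apply: cvg_at_right_filter; exact: cF.
  + by apply: cvg_at_left_filter; exact: cF.
- by move=> y _; rewrite derive1E; have [_ ->] := dF y.
Qed.

Let dint_cauchy l k e : 0 < l -> 0 <= k -> 0 < e ->
  (dint `]0%R, l[%classic `]0%R, l[%classic (cauchy k e) <= (k / e * pi * l)%:E)%E.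
Proof.
move=> l0 k0 e0.
apply: (@le_trans _ _ (\int[mu]_(x in `]0%R, l[) (k / e * pi)%:E)%E).
  apply: ge0_le_integral => //.
  - by move=> x _; apply: integral_ge0 => y _; rewrite lee_fin cauchy_ge0.
  - apply: inner_integral_measurable => //; first exact: measurable_cauchy.
    by move=> z; exact: cauchy_ge0.
  - by move=> x _; exact: inner_cauchy.
have := @integral_cst _ _ _ mu `]0, l[%classic (measurable_itv _) (k / e * pi)%:E.
move=> /= ->; rewrite [X in (_ * X)%E](_ : _ = l%:E) -?EFinM//.
by rewrite lebesgue_measure_itv/= lte_fin l0 sube0.
Qed.

Lemma chord_lip L u x y : `|u x - u y| <= L * `|x - y| ->
  chord u (x, y) <= L ^+ 2.
Proof.
move=> uL; rewrite /chord/=; have [->|xy] := eqVneq x y.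
  by rewrite !subrr normr0 expr0n/= mul0r sqr_ge0.
have t0 : 0 < `|x - y| by rewrite normr_gt0 subr_eq0.
by rewrite ler_pdivrMr ?exprn_gt0// -exprMn lerXn2r ?nnegrE// (le_trans _ uL).
Qed.

(** At distance t the quotient is at most L^2 and at most B^2 / t^2, hence at most
    (L^2 + B^2) / (1 + t^2), and the integral of the latter over the line does
    not depend on l. *)
Lemma gagliardo_bounded l L B u : 0 < l -> measurable_fun [set: T] u ->
  (forall x y : R, 0 < x < l -> 0 < y < l -> `|u x - u y| <= L * `|x - y|) ->
  (forall x y : R, 0 < x < l -> 0 < y < l -> `|u x - u y| <= B) ->
  (gagliardo l u <= ((L ^+ 2 + B ^+ 2) * pi * l)%:E)%E.
Proof.
move=> l0 mu_ uL uB; have LB : 0 <= L ^+ 2 + B ^+ 2 by rewrite addr_ge0 ?sqr_ge0.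
have := dint_cauchy l0 LB (ltr01 : 0 < 1 :> R); rewrite divr1; apply: le_trans.
apply: le_dint => //; first exact: measurable_chord.
- exact: measurable_cauchy.
- exact: chord_ge0.
- by move=> z; exact: cauchy_ge0.
move=> x y; rewrite /= !in_itv/= => xl yl.
rewrite /cauchy/= ler_pdivlMr ?cauchy_den// expr1n mulrDr mulr1.
apply: lerD; first exact: chord_lip (uL _ _ xl yl).
have uBxy := uB _ _ xl yl.
rewrite /chord/=; have [->|xy] := eqVneq x y.
  by rewrite !subrr normr0 expr0n/= mulr0 sqr_ge0.
rewrite -[X in _ * X]real_normK ?num_real// divfK.
  by rewrite lerXn2r ?nnegrE// (le_trans _ uBxy).
by rewrite expf_eq0/= normr_eq0 subr_eq0.
Qed.

(** Near the diagonal the quotients are at most L^2, and away from it they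
    differ by a multiple of h / |x - y|; the scale e separates the two
    regions. *)
Lemma gagliardo_perturb l L h e u w : 0 < l -> 0 <= L -> 0 <= h -> 0 < e ->
  measurable_fun [set: T] u -> measurable_fun [set: T] w ->
  (forall x y : R, 0 < x < l -> 0 < y < l -> `|u x - u y| <= L * `|x - y|) ->
  (forall x y : R, 0 < x < l -> 0 < y < l -> `|w x - w y| <= L * `|x - y|) ->
  (forall x : R, 0 < x < l -> `|u x - w x| <= h) ->
  (gagliardo l u <= gagliardo l w +
     (2 * L ^+ 2 * e * pi * l + 4 * h * L / e * l * l)%:E)%E.
Proof.
move=> l0 L0 h0 e0 mu_ mw uL wL uw.
have k0 : 0 <= 2 * L ^+ 2 * e ^+ 2 by rewrite mulr_ge0 ?sqr_ge0// mulr_ge0 ?sqr_ge0.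
have k1 : 0 <= 4 * h * L / e by rewrite divr_ge0 ?mulr_ge0// ltW.
have mc : measurable_fun [set: T * T] (cauchy (2 * L ^+ 2 * e ^+ 2) e).
  exact: measurable_cauchy.
have mch := measurable_chord mw.
have H : (gagliardo l u <= dint `]0%R, l[%classic `]0%R, l[%classic
    (fun z => (chord w z +
      (cauchy (2 * L ^+ 2 * e ^+ 2) e z + 4 * h * L / e))%R))%E.
  apply: le_dint => //; first exact: measurable_chord.
  - by apply: measurable_funD => //; apply: measurable_funD.
  - exact: chord_ge0.
  - by move=> z; rewrite addr_ge0 ?chord_ge0// addr_ge0// cauchy_ge0.
  move=> x y; rewrite /= !in_itv/= => xl yl.
  have uLxy := uL _ _ xl yl; have wLxy := wL _ _ xl yl.
  have c0 := cauchy_ge0 (x, y) k0 e0.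
  have [te|te] := ltP `|x - y| e.
    apply: (@le_trans _ _ (L ^+ 2)); first exact: chord_lip.
    rewrite -[leLHS]add0r lerD ?chord_ge0// -[leLHS]addr0 lerD//.
    rewrite /cauchy/= ler_pdivlMr ?cauchy_den//
      -(real_normK (num_real (x - y))).
    have -> : 2 * L ^+ 2 * e ^+ 2 = L ^+ 2 * (e ^+ 2 + e ^+ 2) by ring.
    by rewrite ler_wpM2l ?sqr_ge0// lerD2l lerXn2r ?nnegrE// ltW.
  have t0 : 0 < `|x - y| by rewrite (lt_le_trans e0).
  have -> : chord u (x, y) = chord w (x, y) +
      (`|u x - u y| ^+ 2 - `|w x - w y| ^+ 2) / `|x - y| ^+ 2.
    by rewrite /chord/=; ring.
  rewrite lerD2l -[leLHS]add0r lerD//.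
  apply: (@le_trans _ _ (4 * h * L / `|x - y|)); last first.
    by rewrite ler_wpM2l ?lef_pV2 ?posrE// mulr_ge0// mulr_ge0.
  rewrite ler_pdivrMr ?exprn_gt0// expr2 mulrA divfK ?gt_eqF//.
  have D : `|u x - u y| - `|w x - w y| <= 2 * h.
    have := uw _ xl; have := uw _ yl.
    have := ler_distD (w x - w y) (u x - u y) 0; rewrite !subr0.
    have -> : u x - u y - (w x - w y) = (u x - w x) - (u y - w y) by ring.
    have := ler_normB (u x - w x) (u y - w y); lra.
  have := normr_ge0 (u x - u y); have := normr_ge0 (w x - w y).
  set a := `|u x - u y| in D uLxy *; set b := `|w x - w y| in D wLxy *.
  move=> a0 b0; have [ab|ba] := leP a b.
    apply: (@le_trans _ _ 0); first by nra.
    by rewrite !mulr_ge0// ltW.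
  have -> : a ^+ 2 - b ^+ 2 = (a - b) * (a + b) by ring.
  have -> : 4 * h * L * `|x - y| = (2 * h) * (2 * L * `|x - y|) by ring.
  by apply: ler_pM => //; lra.
apply: (le_trans H); rewrite dintD//; last first.
- by move=> z; rewrite addr_ge0// cauchy_ge0.
- exact: chord_ge0.
- by apply: measurable_funD.
apply: leeD => //; rewrite dintD//; last first.
  by move=> z; exact: cauchy_ge0.
rewrite [X in (_ + X <= _)%E](dint_cst _ (ltW l0) (ltW l0)) !subr0.
rewrite [leRHS]EFinD leeD//.
apply: (le_trans (dint_cauchy l0 k0 e0)); rewrite lee_fin.
by rewrite (_ : 2 * L ^+ 2 * e ^+ 2 / e = 2 * L ^+ 2 * e)//; field; rewrite gt_eqF.
Qed.

End GagliardoBounds.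

(** * Reduction to finite packings *)

(** The conditions that [AD] puts on the set of entries of s: two intervals of
    length d are disjoint when their centres are at distance at least d. *)
Definition packed (R : realType) (d l : R) (s : seq R) : Prop :=
  [/\ uniq s, {in s, forall p : R, - (d / 2) < p < l + d / 2} &
      {in s &, forall p q : R, p != q -> d <= `|p - q|}].

Section Profile.
Variable R : realType.
Implicit Types (l d lam Lam h : R) (s : seq R) (u w : R -> R).
Local Notation mu := (@lebesgue_measure R).
Local Notation T := (measurableTypeR R).

Lemma profile_lip lam Lam d s (x y : R) : 0 < d ->
  `|profile lam Lam d s x - profile lam Lam d s y|
  <= (`|lam| + `|Lam + lam| * (size s)%:R) * `|x - y|.
Proof.
move=> d0; rewrite /profile.
have -> : lam * ramp 0 x - (Lam + lam) * \sum_(p <- s) overlap d p x -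
  (lam * ramp 0 y - (Lam + lam) * \sum_(p <- s) overlap d p y) =
  lam * (ramp 0 x - ramp 0 y) -
  (Lam + lam) * \sum_(p <- s) (overlap d p x - overlap d p y).
  rewrite [in RHS]sumrB; move: (\sum_(_ <- _) _) (\sum_(_ <- _) _) => A B; ring.
apply: (le_trans (ler_normB _ _)); rewrite [leRHS]mulrDl !normrM lerD//.
  by rewrite ler_wpM2l// ramp_lip.
rewrite -mulrA ler_wpM2l//; apply: (le_trans (ler_norm_sum _ _ _)).
have -> : (size s)%:R * `|x - y| = \sum_(p <- s) `|x - y|.
  by rewrite big_const_seq count_predT iter_addr_0 mulr_natl.
apply: ler_sum => p _.
by have := overlap_lip p p x y d0; rewrite subrr normr0 addr0.
Qed.

Lemma measurable_profile lam Lam d s : 0 < d ->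
  measurable_fun [set: T] (profile lam Lam d s).
Proof.
move=> d0; apply: continuous_measurable_fun.
by apply: lipschitz_continuous => x y; exact: profile_lip.
Qed.

Lemma gagliardo_shift_cst l c u w : (forall x : R, 0 < x < l -> u x = w x + c) ->
  gagliardo l u = gagliardo l w.
Proof.
move=> uw; apply: eq_dint => x y; rewrite /= !in_itv/= => xl yl.
by rewrite /chord/= !uw//; congr (`|_| ^+ 2 / _); ring.
Qed.

(** An interval that misses ]0, l[ contributes a constant on ]0, l[. *)
Lemma profile_filter lam Lam d l s : 0 < d ->
  exists c : R, forall x : R, 0 < x < l -> profile lam Lam d s x =
    profile lam Lam d [seq p <- s | - (d / 2) < p < l + d / 2] x + c.
Proof.
move=> d0; elim: s => [|p s [c IH]]; first by exists 0 => x _; rewrite addr0.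
have step t y : profile lam Lam d (p :: t) y =
    profile lam Lam d t y - (Lam + lam) * overlap d p y.
  by rewrite /profile big_cons; set S := \sum_(_ <- _) _; ring.
rewrite /=; case: ifPn => [_|].
  by exists c => x xl; rewrite !step IH//; ring.
rewrite negb_and -!leNgt => /orP[pl|lp].
  exists (c - (Lam + lam) * d) => x xl; rewrite step IH// overlapR//; last by lra.
  by ring.
by exists c => x xl; rewrite step IH// overlapL ?mulr0 ?subr0//; lra.
Qed.

Lemma gagliardo_profile_lty lam Lam d l s : 0 < d -> 0 < l ->
  (gagliardo l (profile lam Lam d s) < +oo)%E.
Proof.
move=> d0 l0; set L := `|lam| + `|Lam + lam| * (size s)%:R.
have L0 : 0 <= L by rewrite addr_ge0// mulr_ge0.
have lip (x y : R) := @profile_lip lam Lam d s x y d0.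
apply: (@le_lt_trans _ _ ((L ^+ 2 + (L * l) ^+ 2) * pi * l)%:E); last exact: ltry.
apply: gagliardo_bounded => //; first exact: measurable_profile.
move=> x y /andP[? ?] /andP[? ?]; apply: (le_trans (lip x y)).
by rewrite ler_wpM2l// ler_norml; lra.
Qed.

Lemma gagliardo_ge0 l u : (0 <= gagliardo l u)%E.
Proof. by apply: dint_ge0; exact: chord_ge0. Qed.

Lemma gagliardo_profile_fin_num lam Lam d l s : 0 < d -> 0 < l ->
  gagliardo l (profile lam Lam d s) \is a fin_num.
Proof.
by move=> d0 l0; rewrite ge0_fin_numE ?gagliardo_ge0// gagliardo_profile_lty.
Qed.

End Profile.

Section Packed.
Variable R : realType.
Implicit Types (l d lam Lam : R) (s : seq R) (X : set R).
Local Notation mu := (@lebesgue_measure R).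

Lemma AD_packed d l X : 0 < d -> AD d l X -> packed d l (enum_fset (fset_set X)).
Proof.
move=> d0 [finX Xl tX].
have memX p : p \in enum_fset (fset_set X) -> X p.
  by move=> ps; apply/set_mem; rewrite -in_fset_set.
split; first exact: fset_uniq.
  by move=> p /memX /Xl; rewrite /= in_itv.
move=> p q /memX Xp /memX Xq; rewrite leNgt; apply: contra_neqN => pq.
apply: (tX _ _ Xp Xq); exists ((p + q) / 2).
by move: pq; rewrite ltr_norml => /andP[? ?]; split; rewrite /= in_itv/=; lra.
Qed.

Lemma packed_AD d l s : 0 < d -> packed d l s ->
  AD d l [set` s] /\ perm_eq (enum_fset (fset_set [set` s])) s.
Proof.
move=> d0 [us sl sd]; have finS : finite_set [set` s] by exact: finite_seq.
split.
  split => //.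
  move=> p q /= ps qs [x []]; rewrite /= !in_itv/= => xp xq.
  have [//|pq] := eqVneq p q; have := sd _ _ ps qs pq.
  by rewrite leNgt ltr_norml; lra.
apply: uniq_perm => //.
by move=> p; rewrite in_fset_set// mem_setE.
Qed.

(** A weak derivative determines its function up to a null set and a constant,
    to which the energy is blind: an admissible function may be replaced by the
    profile of its set of centres. *)
Lemma energy_admissibleE lam Lam d l : 0 < d -> 0 < l ->
  energy l @` admissible lam Lam d l =
  [set ((l^-1)%:E * gagliardo l (profile lam Lam d s))%E | s in packed d l].
Proof.
move=> d0 l0; apply/seteqP; split.
  move=> _ [u [X XAD uX] <-]; exists (enum_fset (fset_set X)); first exact: AD_packed.
  have [finX _ _] := XAD; have VX := W1infty_deriv_slope lam Lam l0 d0 finX.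
  have [c uc] := W1infty_deriv_unique l0 uX VX.
  have [uL _ _] := uX.
  by rewrite energyE (gagliardo_ae uL _ uc)//; exact: measurable_profile.
move=> _ [s /(packed_AD d0)[XAD ps] <-]; have [finX _ _] := XAD.
exists (profile lam Lam d (enum_fset (fset_set [set` s]))).
  by exists [set` s] => //; exact: W1infty_deriv_slope.
rewrite energyE; congr (_ * gagliardo l _)%E; apply/funext => x.
by rewrite /profile (perm_big _ ps).
Qed.

(** Distinct centres lie in distinct cells of a partition into cells of length
    d. *)
Lemma packed_size d l s : 0 < d -> 0 < l -> packed d l s ->
  (size s <= (Num.truncn ((l + d) / d)).+1)%N.
Proof.
move=> d0 l0 [us sl sd]; pose f (p : R) := Num.truncn ((p + d / 2) / d).
have fP p : p \in s -> (f p)%:R <= (p + d / 2) / d < (f p).+1%:R.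
  by move=> /sl pl; apply: truncn_itv; rewrite divr_ge0 ?ltW//; lra.
have finj : {in s &, injective f}.
  move=> p q ps qs fpq; apply/eqP; apply: contraT => pq.
  have := sd _ _ ps qs pq.
  have := fP _ ps; have := fP _ qs; rewrite fpq -[(f q).+1%:R]natr1.
  rewrite !ler_pdivlMr// !ltr_pdivrMr// => /andP[q1 q2] /andP[p1 p2].
  move: p2 q2; rewrite !mulrDl !mul1r => p2 q2.
  by rewrite leNgt (_ : `|p - q| < d)// ltr_norml; apply/andP; split; lra.
rewrite -(size_map f) -[X in (_ <= X)%N](size_iota 0); apply: uniq_leq_size.
  by rewrite map_inj_in_uniq.
move=> _ /mapP[p ps ->]; rewrite mem_iota/= add0n ltnS /f; apply: le_truncn.
by rewrite ler_pM2r ?invr_gt0//; have := sl _ ps; lra.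
Qed.

End Packed.

(** * Existence of a minimizer *)

Section Minimizer.
Variable R : realType.
Implicit Types (l d lam Lam h : R) (s : seq R) (u w : R -> R).
Local Notation T := (measurableTypeR R).

Let fine_leD (x y : \bar R) (eps : R) : x \is a fin_num -> y \is a fin_num ->
  (x <= y + eps%:E)%E -> fine x <= fine y + eps.
Proof. by move=> xf yf; rewrite -{1}(fineK xf) -{1}(fineK yf) -EFinD lee_fin. Qed.

Let fine_le_inv (x y : \bar R) : x \is a fin_num -> y \is a fin_num ->
  fine x <= fine y -> (x <= y)%E.
Proof. by move=> xf yf; rewrite -{2}(fineK xf) -{2}(fineK yf) lee_fin. Qed.

Let ler_dist_sym (x y eps : R) :
  x <= y + eps -> y <= x + eps -> `|x - y| <= eps.
Proof. by move=> *; rewrite ler_norml; lra. Qed.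

(** In [gagliardo_perturb], the scale e is chosen first, then the distance h in
    terms of e. *)
Lemma gagliardo_equicontinuous l L eps : 0 < l -> 0 <= L -> 0 < eps ->
  exists2 h : R, 0 < h & forall u w,
    measurable_fun [set: T] u -> measurable_fun [set: T] w ->
    (forall x y : R, `|u x - u y| <= L * `|x - y|) ->
    (forall x y : R, `|w x - w y| <= L * `|x - y|) ->
    (forall x : R, `|u x - w x| <= h) ->
    (gagliardo l u <= gagliardo l w + eps%:E)%E.
Proof.
move=> l0 L0 eps0.
set a := 2 * L ^+ 2 * pi * l.
have a0 : 0 <= a by rewrite mulr_ge0 ?(ltW l0)// mulr_ge0 ?pi_ge0// mulr_ge0 ?sqr_ge0.
pose e := eps / 2 / (a + 1).
have e0 : 0 < e by rewrite !divr_gt0// ltr_wpDl.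
pose b := 4 * L / e * l * l.
have b0 : 0 <= b.
  by rewrite mulr_ge0 ?(ltW l0)// mulr_ge0 ?(ltW l0)// divr_ge0 ?(ltW e0)// mulr_ge0.
pose h := eps / 2 / (b + 1).
have h0 : 0 < h by rewrite !divr_gt0// ltr_wpDl.
exists h => // u w mu_ mw uL wL uw.
apply: le_trans.
  exact: (gagliardo_perturb l0 L0 (ltW h0) e0 mu_ mw
           (fun x y _ _ => uL x y) (fun x y _ _ => wL x y) (fun x _ => uw x)).
rewrite leeD2l// lee_fin.
have -> : 2 * L ^+ 2 * e * pi * l = a * e by rewrite /a; ring.
have -> : 4 * h * L / e * l * l = b * h by rewrite /b; ring.
have ae : a * e <= eps / 2.
  by rewrite /e mulrA ler_pdivrMr ?ltr_wpDl// mulrC ler_wpM2l ?divr_ge0 ?(ltW eps0)// lerDl.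
have bh : b * h <= eps / 2.
  by rewrite /h mulrA ler_pdivrMr ?ltr_wpDl// mulrC ler_wpM2l ?divr_ge0 ?(ltW eps0)// lerDl.
lra.
Qed.

Variables (lam Lam d l : R) (N : nat).
Hypotheses (d0 : 0 < d) (l0 : 0 < l).

Let points (v : 'rV[R]_N) : seq R := [seq v ord0 i | i <- enum 'I_N].

Let F (v : 'rV[R]_N) : R := fine (gagliardo l (profile lam Lam d (points v))).

(* The interval centred at - d / 2 misses ]0, l[, so that a coordinate with this
   value stands for an absent interval. Allowing it, and the other endpoint
   l + d / 2, makes the set of configurations closed. *)
Let K : set 'rV[R]_N :=
  [set v : 'rV[R]_N | forall i, `[- (d / 2), l + d / 2]%classic (v ord0 i)] `&`
  [set v : 'rV[R]_N | forall i j, i != j ->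
    [\/ d <= `|v ord0 i - v ord0 j|, v ord0 i = - (d / 2) | v ord0 j = - (d / 2)]].

Let coord_cont i : continuous (fun v : 'rV[R]_N => v ord0 i).
Proof. exact: coord_continuous. Qed.

Let coord_dist_cont i j : continuous (fun v : 'rV[R]_N => `|v ord0 i - v ord0 j|).
Proof.
move=> v; have fB := @continuousB _ _ _ _ _ _ (@coord_cont i v) (@coord_cont j v).
by have := continuous_comp fB (@norm_continuous _ _ _).
Qed.

Let compact_K : compact K.
Proof.
apply: compact_closedI.
  by apply: (@rV_compact _ N (fun=> `[- (d / 2), l + d / 2]%classic)) => i; exact: segment_compact.
rewrite (_ : [set v | _] = \bigcap_(i in [set: 'I_N]) \bigcap_(j in [set j | i != j])
   ((fun v : 'rV[R]_N => `|v ord0 i - v ord0 j|) @^-1` [set t | d <= t] `|`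
    ((fun v : 'rV[R]_N => v ord0 i) @^-1` [set - (d / 2)] `|`
    (fun v : 'rV[R]_N => v ord0 j) @^-1` [set - (d / 2)]))); last first.
  apply/seteqP; split => v /= H.
    by move=> i _ j ij; have [] := H i j ij; [left|right; left|right; right].
  by move=> i j ij; have [?|[?|?]] := H i I j ij; [constructor 1|constructor 2|constructor 3].
apply: closed_bigI => i _; apply: closed_bigI => j _.
apply: closedU.
  apply: closed_comp; last exact: closed_ge.
  by move=> v _; exact: coord_dist_cont.
apply: closedU; (apply: closed_comp; last exact: closed_eq) => v _;
  exact: coord_cont.
Qed.

Let L : R := `|lam| + `|Lam + lam| * N%:R.

Let points_lip (v : 'rV[R]_N) (x y : R) :
  `|profile lam Lam d (points v) x - profile lam Lam d (points v) y|
  <= L * `|x - y|.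
Proof.
have := @profile_lip _ lam Lam d (points v) x y d0.
by rewrite size_map size_enum_ord.
Qed.

Let points_close (v v' : 'rV[R]_N) (r x : R) : (forall i, `|v ord0 i - v' ord0 i| <= r) ->
  `|profile lam Lam d (points v) x - profile lam Lam d (points v') x|
  <= `|Lam + lam| * N%:R * r.
Proof.
have pE (w : 'rV[R]_N) : \sum_(p <- points w) overlap d p x =
    \sum_(i <- enum 'I_N) overlap d (w ord0 i) x by rewrite big_map.
move=> vr; rewrite /profile !pE.
set A := \sum_(_ <- _) _; set B := \sum_(_ <- _) _.
have -> : lam * ramp 0 x - (Lam + lam) * A - (lam * ramp 0 x - (Lam + lam) * B) =
  - (Lam + lam) * (A - B) by ring.
rewrite /A /B -sumrB.
rewrite normrM normrN -mulrA ler_wpM2l//; apply: (le_trans (ler_norm_sum _ _ _)).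
rewrite -[N in N%:R]size_enum_ord.
have -> : (size (enum 'I_N))%:R * r = \sum_(i <- enum 'I_N) r.
  by rewrite big_const_seq count_predT iter_addr_0 mulr_natl.
apply: ler_sum => i _; apply: le_trans (vr i).
by have := overlap_lip (v ord0 i) (v' ord0 i) x x d0; rewrite subrr normr0 add0r.
Qed.

Let continuous_F : continuous F.
Proof.
move=> v; apply/(@cvgrPdist_le _ _ _ (nbhs v) (nbhs_filter v)) => eps eps0.
have L0 : 0 <= L by rewrite addr_ge0// mulr_ge0.
have [h h0 H] := gagliardo_equicontinuous l0 L0 eps0.
set M := `|Lam + lam| * N%:R.
have M0 : 0 <= M by rewrite mulr_ge0.
pose r := h / (M + 1).
have r0 : 0 < r by rewrite divr_gt0// ltr_wpDl.
have Mr : M * r <= h.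
  by rewrite /r mulrA ler_pdivrMr ?ltr_wpDl// mulrC ler_wpM2l ?(ltW h0)// lerDl.
near=> v'.
have vv' i : `|v ord0 i - v' ord0 i| <= r.
  have : ball v r v' by near: v'; exact: nbhsx_ballx.
  by move=> [_ /(_ ord0 i) /ltW].
have fn (w : 'rV[R]_N) := gagliardo_profile_fin_num lam Lam (points w) d0 l0.
have key (w w' : 'rV[R]_N) : (forall i, `|w ord0 i - w' ord0 i| <= r) ->
    F w <= F w' + eps.
  move=> ww'; apply: (fine_leD (fn w) (fn w')).
  apply: (H _ _ (measurable_profile lam Lam (points w) d0)
    (measurable_profile lam Lam (points w') d0) (points_lip w) (points_lip w')).
  by move=> x; apply: le_trans Mr; exact: points_close.
have k1 := key _ _ vv'.
have v'v i : `|v' ord0 i - v ord0 i| <= r by rewrite distrC.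
exact: (ler_dist_sym k1 (key _ _ v'v)).
Unshelve. all: by end_near. Qed.

Let K_packed v : K v -> exists2 s, packed d l s &
  gagliardo l (profile lam Lam d (points v)) = gagliardo l (profile lam Lam d s).
Proof.
move=> [vl vd]; exists [seq p <- points v | - (d / 2) < p < l + d / 2]; last first.
  have [c Hc] := profile_filter lam Lam l (points v) d0.
  exact: gagliardo_shift_cst Hc.
have sep i j : i != j -> - (d / 2) < v ord0 i -> - (d / 2) < v ord0 j ->
    d <= `|v ord0 i - v ord0 j|.
  move=> ij vi vj; have [//|e|e] := vd i j ij.
    by move: vi; rewrite e ltxx.
  by move: vj; rewrite e ltxx.
split.
- rewrite filter_map map_inj_in_uniq; first by rewrite filter_uniq// enum_uniq.
  move=> i j; rewrite !mem_filter/= => /andP[/andP[vi _] _] /andP[/andP[vj _] _] vij.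
  apply/eqP; apply: contraT => ij; have := sep _ _ ij vi vj.
  by rewrite vij subrr normr0 leNgt d0.
- by move=> p; rewrite mem_filter => /andP[].
- move=> p q; rewrite !mem_filter => /andP[/andP[pl _]] /mapP[i _ pE].
  move=> /andP[/andP[ql _]] /mapP[j _ qE] pq.
  rewrite pE qE; apply: sep; rewrite -?pE -?qE//.
  by apply: contraNneq pq => ij; rewrite pE qE ij.
Qed.

Let packed_K s : (size s <= N)%N -> packed d l s -> exists2 v, K v &
  gagliardo l (profile lam Lam d s) = gagliardo l (profile lam Lam d (points v)).
Proof.
move=> sN [us sl sd]; pose v : 'rV[R]_N := \row_i nth (- (d / 2)) s i.
have vE i : v ord0 i = nth (- (d / 2)) s i by rewrite mxE.
exists v.
  split=> [i|i j ij]; rewrite /= !vE.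
    have [ns|sn] := ltnP i (size s).
      have := sl _ (mem_nth (- (d / 2)) ns); rewrite in_itv/=.
      by move=> /andP[? ?]; rewrite !ltW.
    by rewrite nth_default// in_itv/= lexx/=; move: d0 l0; lra.
  have [ns|sn] := ltnP i (size s); last by rewrite nth_default//; constructor 2.
  have [nj|sj] := ltnP j (size s); last by rewrite (nth_default _ sj); constructor 3.
  by constructor 1; apply: sd; rewrite ?mem_nth// nth_uniq.
have pE : [seq p <- points v | - (d / 2) < p < l + d / 2] = s.
  have -> : points v = s ++ nseq (N - size s) (- (d / 2)).
    rewrite /points (eq_map vE) (map_comp (nth (- (d / 2)) s) val) val_enum_ord.
    rewrite -[in iota 0 N](subnKC sN) iotaD map_cat add0n.
    congr cat; first by rewrite -/(mkseq _ _) mkseq_nth.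
    apply: (@eq_from_nth _ 0); first by rewrite size_map size_iota size_nseq.
    move=> i; rewrite size_map size_iota => iN.
    rewrite (nth_map 0%N) ?size_iota// nth_iota// nth_nseq iN nth_default//.
    exact: leq_addr.
  rewrite filter_cat (all_filterP _); last by apply/allP => p /sl.
  by rewrite filter_nseq ltxx/= cats0.
have [c Hc] := profile_filter lam Lam l (points v) d0.
by apply/esym/(gagliardo_shift_cst (c := c)) => x xl; rewrite Hc// pE.
Qed.

Lemma exists_packed_minimizer_size :
  exists2 s0, packed d l s0 & forall s, (size s <= N)%N -> packed d l s ->
    (gagliardo l (profile lam Lam d s0) <= gagliardo l (profile lam Lam d s))%E.
Proof.
have K0 : K !=set0.
  have [] := @packed_K [::] isT; first by split.
  by move=> v Kv _; exists v.
have [v0 Kv0 Fmin] := compact_EVT_min K0 compact_K (continuous_subspaceT continuous_F).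
rewrite inE in Kv0; have [s0 ps0 s0E] := K_packed Kv0.
exists s0; [exact: ps0|move=> s sN ps].
have [v Kv ->] := packed_K sN ps; rewrite -s0E.
have fn (w : 'rV[R]_N) := gagliardo_profile_fin_num lam Lam (points w) d0 l0.
exact: (fine_le_inv (fn v0) (fn v) (Fmin v (mem_set Kv))).
Qed.

End Minimizer.

Lemma exists_packed_minimizer (R : realType) (lam Lam d l : R) :
  0 < d -> 0 < l ->
  exists2 s0, packed d l s0 & forall s, packed d l s ->
    (gagliardo l (profile lam Lam d s0) <= gagliardo l (profile lam Lam d s))%E.
Proof.
move=> d0 l0.
have [s0 ps0 H] := exists_packed_minimizer_size lam Lam
  (Num.truncn ((l + d) / d)).+1 d0 l0.
exists s0; [exact: ps0|move=> s ps].
exact: (H s (packed_size d0 l0 ps) ps).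
Qed.

(** * Superadditive functions of a real variable *)

Section Fekete.
Variable R : realType.

(** Fekete's lemma. For l = (n + 1) a + r with 0 <= r < a, superadditivity and
    positivity give e l >= (n + 1) e a, hence e l / l >= (1 - a / l) (e a / a);
    so the limit is the supremum of the quotients. *)
Lemma superadditive_cvg (e : R -> R) (C : R) :
  (forall a, 0 < a -> 0 <= e a) ->
  (forall a b, 0 < a -> 0 < b -> e a + e b <= e (a + b)) ->
  (forall a, 0 < a -> e a <= C * a) ->
  exists2 S : R, forall a, 0 < a -> e a <= S * a & e l / l @[l --> +oo] --> S.
Proof.
move=> e0 eD eC; pose E := [set e a / a | a in [set a | 0 < a]].
have supE : has_sup E.
  split; first by exists (e 1 / 1), 1 => //=.
  by exists C => _ [a /= a0 <-]; rewrite ler_pdivrMr// eC.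
have eS a : 0 < a -> e a / a <= sup E.
  by move=> a0; apply: sup_upper_bound => //; exists a.
exists (sup E); first by move=> a a0; rewrite -ler_pdivrMr// eS.
have S0 : 0 <= sup E.
  by apply: le_trans (eS 1 ltr01); rewrite divr1 e0.
have en n a : 0 < a -> n.+1%:R * e a <= e (n.+1%:R * a).
  move=> a0; elim: n => [|n IH]; first by rewrite !mul1r.
  rewrite -[n.+2%:R]natr1 !mulrDl !mul1r; apply: le_trans (eD _ _ _ a0).
    by rewrite lerD2r.
  by rewrite mulr_gt0.
apply/cvgrPdist_le => eps eps0.
have [_ [a /= a0 <-] ea] := sup_adherent (divr_gt0 eps0 (ltr0n _ 2)) supE.
near=> l.
have al : a <= l by near: l; apply: nbhs_pinfty_ge; exact: num_real.
have Sl : a * sup E * 2 / eps <= l by near: l; apply: nbhs_pinfty_ge; exact: num_real.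
have l0 : 0 < l by exact: lt_le_trans al.
have el := eS l l0.
rewrite ger0_norm ?subr_ge0// lerBlDl.
pose n := (Num.truncn (l / a)).-1.
have la1 : 1 <= l / a by rewrite ler_pdivlMr// mul1r.
have /andP[nl ln] : n.+1%:R <= l / a < n.+2%:R.
  rewrite /n prednK; last by rewrite -[X in (X <= _)%N](@truncn1 R) le_truncn.
  by apply: truncn_itv; rewrite divr_ge0 ?ltW.
have nal : n.+1%:R * e a <= e l.
  move: nl; rewrite ler_pdivlMr// le_eqVlt => /predU1P[<-|nl]; first exact: en.
  have r0 : 0 < l - n.+1%:R * a by rewrite subr_gt0.
  have na0 : 0 < n.+1%:R * a by rewrite mulr_gt0.
  apply: (le_trans (en n a a0)); have := eD _ _ na0 r0.
  rewrite subrKC; apply: le_trans; rewrite lerDl; exact: e0.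
rewrite -lerBlDr ler_pdivlMr//; apply: le_trans nal.
have Nl : n.+1%:R * a <= l by move: nl; rewrite ler_pdivlMr.
move: ln; rewrite -[n.+2%:R]natr1 ltr_pdivrMr// => ln.
have eaa : e a / a * a = e a by rewrite divfK// gt_eqF.
move: Sl; rewrite ler_pdivrMr// => Sl.
have Sl2 : a * sup E <= l * eps / 2 by lra.
rewrite -eaa mulrA.
move: (e a / a) (n.+1%:R : R) ea ln (ler0n R n.+1) Nl => q N Sq lN N0 Nl.
have h1 : N * a * (sup E - eps / 2) <= N * q * a.
  by rewrite mulrAC ler_wpM2r ?(ltW a0)// ler_wpM2l// ltW.
have h2 : (l - a) * sup E <= N * a * sup E.
  by rewrite ler_wpM2r//; lra.
have h3 : N * a * eps <= l * eps by rewrite ler_wpM2r// ltW.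
lra.
Unshelve. all: by end_near. Qed.

End Fekete.

(** * Superadditivity of the energy *)

Section Superadditivity.
Variable R : realType.
Implicit Types (a b l d lam Lam : R) (s : seq R) (A B : set R).
Local Notation mu := (@lebesgue_measure R).
Local Notation T := (measurableTypeR R).

Lemma dint_subset A B A' B' (f : T * T -> R) :
  measurable A -> measurable B -> measurable A' -> measurable B' ->
  measurable_fun [set: T * T] f -> (forall z, 0 <= f z) ->
  A `<=` A' -> B `<=` B' -> (dint A B f <= dint A' B' f)%E.
Proof.
move=> mA mB mA' mB' mf f0 AA' BB'; rewrite !dintE//.
apply: ge0_subset_integral; [exact: measurableX|exact: measurableX| | |].
- by apply/measurable_EFinP; exact: measurable_funS mf.
- by move=> z _; rewrite lee_fin.
- by move=> z [? ?]; split; [exact: AA'|exact: BB'].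
Qed.

Lemma dint_setU A B (f : T * T -> R) :
  measurable A -> measurable B -> A `&` B = set0 ->
  measurable_fun [set: T * T] f -> (forall z, 0 <= f z) ->
  (dint A A f + dint B B f <= dint (A `|` B) (A `|` B) f)%E.
Proof.
move=> mA mB AB mf f0; have mAB : measurable (A `|` B) by exact: measurableU.
have mf' D : measurable_fun D (EFin \o f).
  by apply/measurable_EFinP; exact: measurable_funS mf.
have mAA : measurable (A `*` A) by exact: measurableX.
have mBB : measurable (B `*` B) by exact: measurableX.
rewrite !dintE// -ge0_integral_setU//; first 1 last.
- by move=> z _; rewrite lee_fin.
- apply/disj_setPS => -[x y] [[/= Ax _] [/= Bx _]].
  by have : (A `&` B) x by []; rewrite AB.
apply: ge0_subset_integral => //; [exact: measurableU|exact: measurableX| |].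
- by move=> z _; rewrite lee_fin.
- by move=> z [[? ?]|[? ?]]; split; by [left|right].
Qed.

(** Lebesgue measure is invariant under translations because its image under a
    translation agrees with it on half-open intervals. *)
Let integral_shift a b c (f : T -> \bar R) : measurable_fun [set: T] f ->
  (forall x, 0 <= f x)%E ->
  (\int[mu]_(x in `](a + c)%R, (b + c)%R[) f x = \int[mu]_(x in `]a, b[) f (x + c)%R)%E.
Proof.
move=> mf f0.
have mshift : measurable_fun [set: T] (fun x : T => x + c : T).
  by apply: measurable_funD.
have -> : `]a, b[%classic = (fun x : T => x + c : T) @^-1` `]a + c, b + c[.
  by apply/seteqP; split => x; rewrite /= !in_itv/= !ltrD2r.
rewrite -(@ge0_integral_pushforward _ _ _ _ _ _ mshift mu _ f)//.
  apply: eq_measure_integral => A mA _.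
  apply: lebesgue_measure_unique => // _ [[p q]] _ <-.
  rewrite /= /pushforward.
  have -> : (fun x : T => x + c : T) @^-1` `]p, q] = `]p - c, q - c]%classic.
    by apply/seteqP; split => x; rewrite /= !in_itv/= ltrBlDr lerBrDr.
  rewrite !lebesgue_measure_itv/= !lte_fin ltrD2r; case: ifPn => // _.
  by rewrite -!EFinB; congr EFin; ring.
exact: measurable_funS mf.
Qed.

Let chord_shift (u : R -> R) c (x y : R) :
  chord u (x + c, y + c) = chord (fun t => u (t + c)) (x, y).
Proof. by rewrite /chord/=; congr (_ / `|_| ^+ 2); ring. Qed.

Lemma dint_chord_shift a b u : measurable_fun [set: T] u ->
  dint `]a, a + b[ `]a, a + b[ (chord u) = gagliardo b (fun x => u (x + a)).
Proof.
move=> mu_.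
have -> : (`]a, a + b[%classic : set R) = `]0 + a, b + a[%classic.
  by rewrite add0r addrC.
rewrite /dint integral_shift.
- apply: eq_integral => x _; rewrite integral_shift.
  + by apply: eq_integral => y _; rewrite chord_shift.
  + apply/measurable_EFinP.
    apply: (measurableT_comp (measurable_chord mu_) (g := fun y => (x + a, y))).
    exact: pair1_measurable.
  + by move=> y; rewrite lee_fin chord_ge0.
- apply: inner_integral_measurable => //; last exact: chord_ge0.
  exact: measurable_chord.
- by move=> x; apply: integral_ge0 => y _; rewrite lee_fin chord_ge0.
Qed.

Let packed_window d l l' a s : packed d l s ->
  packed d l' [seq p <- [seq q - a | q <- s] | - (d / 2) < p < l' + d / 2].
Proof.
move=> [us sl sd]; split.
- by rewrite filter_uniq// map_inj_uniq//; exact: addIr.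
- by move=> p; rewrite mem_filter => /andP[].
- move=> p q; rewrite !mem_filter => /andP[_ /mapP[p' ps ->]].
  move=> /andP[_ /mapP[q' qs ->]] pq.
  have -> : p' - a - (q' - a) = p' - q' by ring.
  by apply: sd => //; apply: contraNneq pq => ->.
Qed.

(** Translating the window to the origin and dropping the centres whose intervals
    miss it leaves a packing, and changes the profile by a constant. *)
Lemma gagliardo_window lam Lam d a b l s : 0 < d -> 0 <= a -> packed d l s ->
  exists2 s', packed d b s' &
    dint `]a, a + b[ `]a, a + b[ (chord (profile lam Lam d s)) =
    gagliardo b (profile lam Lam d s').
Proof.
move=> d0 a0 ps.
exists [seq p <- [seq q - a | q <- s] | - (d / 2) < p < b + d / 2].
  exact: packed_window ps.
rewrite dint_chord_shift; last exact: measurable_profile.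
have [c Hc] := profile_filter lam Lam b [seq q - a | q <- s] d0.
apply: (gagliardo_shift_cst (c := c + lam * a)) => x xb.
rewrite addrA -Hc// /profile big_map !rampR; [|lra..].
have -> : \sum_(p <- s) overlap d (p - a) x = \sum_(p <- s) overlap d p (x + a).
  apply: eq_bigr => p _.
  by rewrite /overlap /ramp; congr (Num.max _ _ - Num.max _ _); ring.
by set S := \sum_(_ <- _) _; ring.
Qed.

(** The two windows ]0, a[ and ]a, a + b[ have disjoint squares inside the square
    of ]0, a + b[; the rest of that square only adds energy. *)
Lemma gagliardo_superadditive lam Lam d a b s :
  0 < d -> 0 < a -> 0 < b -> packed d (a + b) s ->
  exists s1 s2, [/\ packed d a s1, packed d b s2 &
    (gagliardo a (profile lam Lam d s1) + gagliardo b (profile lam Lam d s2)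
     <= gagliardo (a + b) (profile lam Lam d s))%E].
Proof.
move=> d0 a0 b0 ps.
have [s1 ps1 E1] := gagliardo_window lam Lam a d0 (lexx 0) ps.
have [s2 ps2 E2] := gagliardo_window lam Lam b d0 (ltW a0) ps.
exists s1, s2; split; [exact: ps1|exact: ps2|].
rewrite -E1 -E2 add0r.
have mc : measurable_fun [set: T * T] (chord (profile lam Lam d s)).
  by apply: measurable_chord; exact: measurable_profile.
have disj : (`]0, a[ `&` `]a, a + b[)%classic = set0 :> set R.
  rewrite -subset0 => x [] /=; rewrite !in_itv/=.
  by move=> /andP[_ xa] /andP[ax _]; lra.
apply: (le_trans (dint_setU (measurable_itv _) (measurable_itv _) disj mc
  (@chord_ge0 _ _))).
have sub : (`]0, a[ `|` `]a, a + b[)%classic `<=` `]0, a + b[.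
  by move=> x [|]; rewrite /= !in_itv/= => /andP[? ?]; apply/andP; split; lra.
apply: (dint_subset _ _ _ _ mc (@chord_ge0 _ _) sub sub);
  by [exact: measurable_itv|exact: measurableU].
Qed.

End Superadditivity.

(** * A periodic competitor *)

Section Periodic.
Variables (R : realType) (lam Lam d : R).
Hypotheses (lam0 : 0 < lam) (Lam0 : 0 < Lam) (d0 : 0 < d).
Local Notation T := (measurableTypeR R).

(* One interval of length d per period P: the rise lam * (P - d) compensates the
   fall Lam * d. *)
Let P := d * (Lam + lam) / lam.

Let dP : d <= P.
Proof. by rewrite /P ler_pdivlMr// ler_pM2l// lerDr ltW. Qed.

Let P0 : 0 < P. Proof. exact: lt_le_trans dP. Qed.

Let comb n : seq R := [seq k%:R * P | k <- iota 0 n].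

Let sum_comb n (f : R -> R) :
  \sum_(p <- comb n) f p = \sum_(0 <= k < n) f (k%:R * P).
Proof. by rewrite big_map /index_iota subn0. Qed.

Let telescope_ramp n c (x : R) :
  \sum_(0 <= k < n) (ramp (k%:R * P + c) x - ramp (k.+1%:R * P + c) x) =
  ramp c x - ramp (n%:R * P + c) x.
Proof.
elim: n => [|n IH]; first by rewrite big_geq// mul0r add0r subrr.
by rewrite big_nat_recr//= IH; ring.
Qed.

Let packed_comb n l : (n%:R <= l / P + 1) -> packed d l (comb n).
Proof.
move=> nl; split.
- rewrite map_inj_uniq ?iota_uniq// => i j ijP.
  have := mulIf (lt0r_neq0 P0) ijP => /eqP.
  by rewrite eqr_nat => /eqP.
- move=> _ /mapP[k kn ->].
  move: kn; rewrite mem_iota/= add0n => kn.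
  have k0 : 0 <= k%:R * P by rewrite mulr_ge0// ltW.
  have : k.+1%:R <= l / P + 1 by apply: le_trans nl; rewrite ler_nat.
  by rewrite -natr1 lerD2r ler_pdivlMr// => kl; have := d0 => d0'; apply/andP; split; lra.
- move=> _ _ /mapP[i _ ->] /mapP[j _ ->] ij.
  rewrite -mulrBl normrM (gtr0_norm P0); apply: (le_trans dP).
  rewrite ler_peMl ?(ltW P0)//.
  have : i != j by apply: contraNneq ij => ->.
  rewrite neq_ltn => /orP[] h.
    rewrite distrC ger0_norm ?subr_ge0 ?ler_nat 1?ltnW// lerBrDr.
    by rewrite nat1r ler_nat.
  rewrite ger0_norm ?subr_ge0 ?ler_nat 1?ltnW// lerBrDr.
  by rewrite nat1r ler_nat.
Qed.

(** The increment of an overlap is at most that of a difference of ramps with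
    kinks one period apart, and these differences telescope: at most x - y
    is covered by intervals between y and x. *)
Let comb_lip n (x y : R) : `|profile lam Lam d (comb n) x
  - profile lam Lam d (comb n) y| <= (Lam + 2 * lam) * `|x - y|.
Proof.
wlog yx : x y / y <= x.
  move=> H; have [|/ltW] := leP y x; first exact: H.
  by move=> /H; rewrite distrC (distrC y).
have s0 : 0 <= \sum_(0 <= k < n) (overlap d (k%:R * P) x - overlap d (k%:R * P) y).
  apply: sumr_ge0 => k _; rewrite /overlap.
  have pp : k%:R * P - d / 2 <= k%:R * P + d / 2 by have := d0; lra.
  by have := ramp_incr_antitone pp yx; lra.
have s1 : \sum_(0 <= k < n) (overlap d (k%:R * P) x - overlap d (k%:R * P) y)
    <= x - y.
  pose c := - (d / 2).
  apply: (@le_trans _ _ (\sum_(0 <= k < n)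
      (ramp (k%:R * P + c) x - ramp (k.+1%:R * P + c) x) -
      \sum_(0 <= k < n) (ramp (k%:R * P + c) y - ramp (k.+1%:R * P + c) y))).
    rewrite -sumrB; apply: ler_sum => k _; rewrite /overlap.
    have -> : k.+1%:R * P + c = k%:R * P - d / 2 + P.
      by rewrite -natr1 /c; ring.
    have pp : k%:R * P + d / 2 <= k%:R * P - d / 2 + P by have := dP; lra.
    by have := ramp_incr_antitone pp yx; rewrite /c; lra.
  rewrite !telescope_ramp; have /andP[_] := ramp_incr c yx.
  by have /andP[] := ramp_incr (n%:R * P + c) yx; lra.
have r0 := ramp_incr 0 yx.
have -> : profile lam Lam d (comb n) x - profile lam Lam d (comb n) y =
    lam * (ramp 0 x - ramp 0 y) - (Lam + lam) *
    \sum_(0 <= k < n) (overlap d (k%:R * P) x - overlap d (k%:R * P) y).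
  rewrite /profile !sum_comb [in RHS]sumrB.
  by move: (\sum_(_ <= _ < _) _) (\sum_(_ <= _ < _) _) => A B; ring.
move: (\sum_(_ <= _ < _) _) s0 s1 => S s0 s1.
rewrite (@ger0_norm _ (x - y)) ?subr_ge0// ler_norml.
have := lam0; have := Lam0 => Lam0' lam0'.
have LS : (Lam + lam) * S <= (Lam + lam) * (x - y) by rewrite ler_wpM2l// ltW// addr_gt0.
have LS0 : 0 <= (Lam + lam) * S by rewrite mulr_ge0// ltW// addr_gt0.
case/andP: r0 => r0 r1.
have lr : lam * (ramp 0 x - ramp 0 y) <= lam * (x - y) by rewrite ler_wpM2l// ltW.
have lr0 : 0 <= lam * (ramp 0 x - ramp 0 y) by rewrite mulr_ge0// ltW.
have lxy : 0 <= lam * (x - y) by rewrite mulr_ge0 ?subr_ge0// ltW.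
have Lxy : 0 <= Lam * (x - y) by rewrite mulr_ge0 ?subr_ge0// ltW.
by apply/andP; split; lra.
Qed.

(** The multiple P / d of the overlap at k P lies between two differences of ramps
    with kinks one period apart, those at k P and (k + 1) P and those at
    (k - 1) P and k P. Both sums over k telescope, to x and to at most x + P. *)
Let comb_bounded n l (x : R) : l <= n%:R * P -> 0 < x < l ->
  - (lam * P) <= profile lam Lam d (comb n) x <= 0.
Proof.
move=> ln /andP[x0 xl]; rewrite /profile sum_comb rampR ?(ltW x0)// subr0.
set S := \sum_(_ <= _ < _) _.
have lo : d * x <= P * S.
  have -> : d * x = \sum_(0 <= k < n)
      d * (ramp (k%:R * P + 0) x - ramp (k.+1%:R * P + 0) x).
    rewrite -mulr_sumr telescope_ramp addr0 rampR ?(ltW x0)// rampL; last by lra.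
    by rewrite !subr0.
  rewrite mulr_sumr; apply: ler_sum => k _; rewrite !addr0 -natr1 mulrDl mul1r /overlap.
  have := dP; have := d0; move: (k%:R * P) => q d0' dP'.
  case: (rampP q x) => ?; case: (rampP (q + P) x) => ?;
  case: (rampP (q - d / 2) x) => ?; case: (rampP (q + d / 2) x) => ?; nra.
have hi : P * S <= d * (x + P).
  apply: (@le_trans _ _ (\sum_(0 <= k < n)
      d * (ramp (k%:R * P - P) x - ramp (k.+1%:R * P - P) x))).
    rewrite mulr_sumr; apply: ler_sum => k _; rewrite -natr1 mulrDl mul1r addrK /overlap.
    have := dP; have := d0; move: (k%:R * P) => q d0' dP'.
    case: (rampP (q - P) x) => ?; case: (rampP q x) => ?;
    case: (rampP (q - d / 2) x) => ?; case: (rampP (q + d / 2) x) => ?; nra.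
  rewrite -mulr_sumr telescope_ramp ler_pM2l// rampR; last by have := P0; lra.
  by rewrite opprK lerBlDr lerDl ramp_ge0.
have PE : (Lam + lam) = lam * P / d.
  by rewrite /P; field; rewrite !gt_eqF.
have -> : lam * x - (Lam + lam) * S = lam / d * (d * x - P * S).
  by rewrite PE; field; rewrite gt_eqF.
have ld : 0 < lam / d by rewrite divr_gt0.
apply/andP; split; last by rewrite pmulr_rle0// subr_le0.
have -> : - (lam * P) = lam / d * (- (d * P)).
  by field; rewrite gt_eqF.
by rewrite ler_pM2l//; lra.
Qed.

Lemma exists_packed_bounded : exists C : R, forall l, 0 < l ->
  exists2 s, packed d l s & (gagliardo l (profile lam Lam d s) <= (C * l)%:E)%E.
Proof.
exists (((Lam + 2 * lam) ^+ 2 + (lam * P) ^+ 2) * pi) => l l0.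
have /andP[nl ln] := truncn_itv (divr_ge0 (ltW l0) (ltW P0)).
set n := (Num.truncn (l / P)).+1; exists (comb n).
  by apply: packed_comb; rewrite /n -natr1 lerD2r.
have lnP : l <= n%:R * P by rewrite -ler_pdivrMr// ltW.
apply: (gagliardo_bounded l0 (measurable_profile lam Lam (comb n) d0)).
  by move=> x y _ _; exact: comb_lip.
move=> x y xl yl; have := comb_bounded lnP xl; have := comb_bounded lnP yl.
by move=> /andP[? ?] /andP[? ?]; rewrite ler_norml; apply/andP; split; lra.
Qed.

End Periodic.

(** * Positivity *)

Section Positivity.
Variable R : realType.
Implicit Types (l d lam Lam : R) (s : seq R).
Local Notation T := (measurableTypeR R).

(** On some subinterval of ]0, l[ the profile is affine with slope lam or
    - Lam: either there is no interval at all, or the part of some interval that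
    lies in ]0, l[ will do. *)
Lemma profile_affine_piece lam Lam d l s : 0 < lam -> 0 < Lam -> lam <= Lam ->
  0 < d -> 0 < l -> packed d l s ->
  exists a b : R, [/\ 0 <= a, a < b, b <= l & forall x y : R, a < x < b ->
    a < y < b -> lam * `|x - y| <=
      `|profile lam Lam d s x - profile lam Lam d s y|].
Proof.
move=> lam0 Lam0 le d0 l0 [us sl sd].
case: s us sl sd => [_ _ _|p s us sl sd].
  exists 0, l; split => // x y /andP[x0 _] /andP[y0 _].
  rewrite /profile !big_nil !mulr0 !subr0 (rampR (ltW x0)) (rampR (ltW y0)) !subr0.
  by rewrite -mulrBr normrM (gtr0_norm lam0).
have /andP[pl pr] := sl p (mem_head _ _).
exists (Num.max 0 (p - d / 2)), (Num.min l (p + d / 2)).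
split; first by rewrite le_max lexx.
- by rewrite lt_min !gt_max; apply/andP; split; apply/andP; split; lra.
- by rewrite ge_min lexx.
move=> x y; rewrite !lt_min !gt_max.
move=> /andP[/andP[x0 px] /andP[xl xp]] /andP[/andP[y0 py] /andP[yl yp]].
have rest : \sum_(q <- s) overlap d q x = \sum_(q <- s) overlap d q y.
  apply: eq_big_seq => q qs.
  have qp : p != q.
    by apply: contraTneq us => ->; rewrite /= qs.
  have := sd _ _ (mem_head _ _) (mem_behead (s := p :: s) qs) qp.
  rewrite ler_normr => /orP[h|h].
    by rewrite !overlapR//; lra.
  by rewrite !overlapL//; lra.
have -> : profile lam Lam d (p :: s) x - profile lam Lam d (p :: s) y =
    - Lam * (x - y).
  rewrite /profile !big_cons rest /overlap !(rampR (ltW x0)) !(rampR (ltW y0)).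
  rewrite (rampR (ltW px)) (rampR (ltW py)) (rampL (ltW xp)) (rampL (ltW yp)).
  by move: (\sum_(_ <- _) _) => S; ring.
by rewrite normrM normrN (gtr0_norm Lam0) ler_wpM2r.
Qed.

Lemma gagliardo_gt0 lam Lam d l s : 0 < lam -> 0 < Lam -> lam <= Lam ->
  0 < d -> 0 < l -> packed d l s -> (0 < gagliardo l (profile lam Lam d s))%E.
Proof.
move=> lam0 Lam0 le d0 l0 ps.
have [a [b [a0 ab bl H]]] := profile_affine_piece lam0 Lam0 le d0 l0 ps.
have mc : measurable_fun [set: T * T] (chord (profile lam Lam d s)).
  by apply: measurable_chord; exact: measurable_profile.
pose m := (a + b) / 2.
have am : a <= m by rewrite /m; lra.
have mb : m <= b by rewrite /m; lra.
(* the two halves of the piece avoid the diagonal *)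
have lo : (dint `]a, m[ `]m, b[ (cst (lam ^+ 2)%R) <=
           dint `]a, m[ `]m, b[ (chord (profile lam Lam d s)))%E.
  apply: (le_dint (measurable_itv _) (measurable_itv _) _ mc _ (@chord_ge0 _ _)).
  - exact: measurable_cst.
  - by move=> z; rewrite sqr_ge0.
  move=> x y; rewrite /= !in_itv/= => /andP[ax xm] /andP[my yb].
  have xy : x != y by apply: contraTneq xm => ->; rewrite -leNgt ltW.
  have t0 : 0 < `|x - y| by rewrite normr_gt0 subr_eq0.
  rewrite /chord/= ler_pdivlMr ?exprn_gt0// -exprMn lerXn2r ?nnegrE//.
    by rewrite mulr_ge0// ltW.
  by apply: H; apply/andP; split=> //; [exact: lt_le_trans mb|exact: le_lt_trans my].
have subl : (`]a, m[%classic : set R) `<=` `]0, l[.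
  by move=> x; rewrite /= !in_itv/= => /andP[? ?]; apply/andP; split; lra.
have subr : (`]m, b[%classic : set R) `<=` `]0, l[.
  by move=> x; rewrite /= !in_itv/= => /andP[? ?]; apply/andP; split; lra.
have up := dint_subset (measurable_itv _) (measurable_itv _) (measurable_itv _)
  (measurable_itv _) mc (@chord_ge0 _ _) subl subr.
apply: lt_le_trans (le_trans lo up).
rewrite dint_cst// lte_fin !mulr_gt0 ?exprn_gt0// /m; lra.
Qed.

End Positivity.

(** * The limit energy *)

Definition least_gagliardo (R : realType) (lam Lam d l m : R) : Prop :=
  (exists2 s, packed d l s & gagliardo l (profile lam Lam d s) = m%:E) /\
  (forall s, packed d l s -> (m%:E <= gagliardo l (profile lam Lam d s))%E).

Lemma exists_least_gagliardo (R : realType) (lam Lam d l : R) :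
  0 < d -> 0 < l -> exists m, least_gagliardo lam Lam d l m.
Proof.
move=> d0 l0; have [s ps H] := exists_packed_minimizer lam Lam d0 l0.
have E := fineK (gagliardo_profile_fin_num lam Lam s d0 l0).
exists (fine (gagliardo l (profile lam Lam d s))); split.
  by exists s; [exact: ps|rewrite E].
by move=> t pt; rewrite E; exact: H.
Qed.

Lemma min_energyE (R : realType) (lam Lam d l m : R) : 0 < d -> 0 < l ->
  least_gagliardo lam Lam d l m -> min_energy lam Lam d l = (m / l)%:E /\
  (energy l @` admissible lam Lam d l) (m / l)%:E.
Proof.
move=> d0 l0 [[s ps sm] H].
have attained : (energy l @` admissible lam Lam d l) (m / l)%:E.
  rewrite (energy_admissibleE _ _ d0 l0); exists s; first exact: ps.
  by rewrite sm -EFinM mulrC.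
split; last exact: attained.
apply/eqP; rewrite eq_le; apply/andP; split; first exact: ereal_inf_lbound.
apply: le_ereal_inf_tmp; rewrite (energy_admissibleE _ _ d0 l0) => _ [t pt <-].
rewrite mulrC EFinM; apply: lee_wpmul2l; first by rewrite lee_fin invr_ge0 ltW.
exact: H.
Qed.

Unset Implicit Arguments.

Theorem theorem2p3 (R : realType) (lambda Lambda delta : R)
    (hlambda : 0 < lambda) (hLambda : 0 < Lambda) (hle : lambda <= Lambda)
    (hdelta : 0 < delta) :
  (* the infimum defining [min_energy] is a minimum *)
  (forall l : R, 0 < l ->
     (energy l @` admissible lambda Lambda delta l)
       (min_energy lambda Lambda delta l)) /\
  exists c_infty : \bar R,
    [/\ (0 < c_infty)%E, (c_infty < +oo)%E &
        min_energy lambda Lambda delta l @[l --> +oo] --> c_infty].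
Proof.
split=> [l l0|].
  have [m Hm] := exists_least_gagliardo lambda Lambda hdelta l0.
  by have [-> ] := min_energyE hdelta l0 Hm.
have /choice[e eP] : forall l, exists m, 0 < l ->
    least_gagliardo lambda Lambda delta l m.
  move=> l; have [l0|] := ltP 0 l; last by exists 0; lra.
  have [m Hm] := exists_least_gagliardo lambda Lambda hdelta l0.
  by exists m.
have [C HC] := exists_packed_bounded hlambda hLambda hdelta.
have e_gt0 l : 0 < l -> 0 < e l.
  move=> l0; have [[s ps sm] _] := eP _ l0; rewrite -lte_fin -sm.
  exact: gagliardo_gt0 ps.
have e_super a b : 0 < a -> 0 < b -> e a + e b <= e (a + b).
  move=> a0 b0; have [[s ps sm] _] := eP _ (addr_gt0 a0 b0).
  have [s1 [s2 [ps1 ps2 H]]] := gagliardo_superadditive lambda Lambda hdelta a0 b0 ps.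
  have [_ H1] := eP _ a0; have [_ H2] := eP _ b0.
  rewrite -lee_fin EFinD -sm; apply: le_trans H.
  by apply: leeD; [exact: H1|exact: H2].
have e_le a : 0 < a -> e a <= C * a.
  move=> a0; have [s ps sC] := HC _ a0; have [_ H] := eP _ a0.
  by rewrite -lee_fin; exact: le_trans (H _ ps) sC.
have [S eS eS_cvg] := superadditive_cvg (fun a a0 => ltW (e_gt0 a a0)) e_super e_le.
exists S%:E; split.
- rewrite lte_fin; have := e_gt0 1 ltr01; have := eS 1 ltr01; lra.
- exact: ltry.
- have : (e l / l)%:E @[l --> +oo] --> S%:E.
    by apply: cvg_comp eS_cvg _; exact: cvg_id.
  apply: cvg_trans; apply: near_eq_cvg; near=> l.
  have l0 : 0 < l by near: l; apply: nbhs_pinfty_gt; exact: num_real.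
  by have [-> _] := min_energyE hdelta l0 (eP _ l0).
Unshelve. all: by end_near. Qed.
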